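(* Let $\Gamma$ be a finite Abelian group such that $\Gamma\cong L\times H$, where $|L|=2^{\eta}$ for some natural number $\eta$, $|I(L)|>1$, and $|H|\equiv 5 \pmod 6$. Then $\Gamma$ has the $4$-Zero-Sum Partition Property.
   Context: For a finite Abelian group $\Gamma$ (written additively, identity $0$), $\Gamma^*=\Gamma\setminus\{0\}$, and $I(\Gamma)$ denotes the set of involutions of $\Gamma$, i.e. elements $\iota\neq 0$ with $2\iota=0$. A finite Abelian group $\Gamma$ of order $m$ has the $x$-Zero-Sum Partition Property ($x$-ZSPP) if for every positive integer $t$ and every sequence of positive integers $m_1,\dots,m_t$ with $\sum_{i=1}^t m_i=m-1$ and $m_i\ge x$ for all $i$, there is a partition of $\Gamma^*$ into pairwise disjoint subsets $S_1,\dots,S_t$ with $|S_i|=m_i$ and $\sum_{s\in S_i}s=0$ for every $i$. *)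

(* Defs.v *)
From HB Require Import structures.
From mathcomp Require Import all_boot all_order all_algebra.
Set Implicit Arguments. Unset Strict Implicit. Unset Printing Implicit Defensive.
Import GRing.Theory.
Local Open Scope ring_scope.

Definition involutions (G : finZmodType) : {set G} :=
  [set x : G | (x != 0) && (x + x == 0)].

Definition ZSPP (x : nat) (G : finZmodType) : Prop :=
  forall (t : nat) (m : 'I_t -> nat),
    (0 < t)%N ->
    (forall i, 0 < m i)%N ->
    (forall i, x <= m i)%N ->
    (\sum_(i < t) m i)%N = #|G|.-1 ->
    exists S : 'I_t -> {set G},
      [/\ forall i j, i != j -> [disjoint S i & S j],
          \bigcup_(i < t) S i = [set~ (0 : G)],
          forall i, #|S i| = m i &
          forall i, \sum_(s in S i) s = 0].

(* Main.v *)
(* Let V be the 2-torsion of L, let K = {0, u, v, u + v} be a Klein subgroup of V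
   and let R be the set of elements of L x H that are not 2-torsion. V minus 0 is
   cut into the triple K minus 0 and q = |V|/4 - 1 cosets of K, each with sum 0.
   Inside R one packs disjoint six-sets {+-x, +-y, +-z} with x + y + z = 0, each of
   which is two zero-sum triples; what is left of R consists of pairs {x, -x}.
   After cutting all parts into parts of size 4, ..., 7, every part of size 4, 6
   or 7 can absorb a coset of K, every odd part needs a triple, and the rest is
   filled with pairs. If there are too few parts of size 4, 6, 7, a coset
   r + K is joined with a six-set for which x + y + z = u, which gives the two
   zero-sum 5-sets {r, r + u, x, y, z} and {r + v, r + u + v, -x, -y, -z}.

   About three fifths of L x H must be covered by six-sets. They are of the form
   +-(a, x), +-(b, x), -+(a + b, 2x), where x runs over H minus 0 up to sign and
   the pair (a, b) over |L|/4 pairs of elements of L chosen according to the colour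
   of x in a 3-colouring of H in which x and 2x have different colours (2 and 3 are
   units in H): sums of pairs of one colour must avoid, up to sign, the members of
   pairs of the other colours. *)
Require Import Defs.
From HB Require Import structures.
From mathcomp Require Import all_boot all_order all_algebra.
From mathcomp Require Import zify ring.
Set Implicit Arguments. Unset Strict Implicit. Unset Printing Implicit Defensive.
Import GRing.Theory.
Local Open Scope ring_scope.

(** * Splitting a sequence into zero-sum blocks of prescribed sizes *)

Definition zs_split (G : zmodType) (s : seq G) (ms : seq nat) : Prop :=
  exists2 ps : seq (seq G), perm_eq (flatten ps) s &
    perm_eq (map size ps) ms /\ all (fun p => \sum_(x <- p) x == 0) ps.

Lemma zs_split_perm (G : zmodType) (s s' : seq G) ms ms' :
  perm_eq s s' -> perm_eq ms ms' -> zs_split s ms -> zs_split s' ms'.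
Proof.
move=> ss' mm' [ps ps_s [ps_m ps0]]; exists ps; first exact: perm_trans ss'.
by split=> //; apply: perm_trans mm'.
Qed.

Lemma zs_split_cat (G : zmodType) (s s' : seq G) ms ms' :
  zs_split s ms -> zs_split s' ms' -> zs_split (s ++ s') (ms ++ ms').
Proof.
move=> [ps ps_s [ps_m ps0]] [qs qs_s [qs_m qs0]]; exists (ps ++ qs).
  by rewrite flatten_cat perm_cat.
by rewrite map_cat perm_cat // all_cat ps0 qs0.
Qed.

(** A permutation of indices puts the blocks in the order of the sizes; they are then cut after the
    first [size ms]. *)
Lemma zs_split_uncat (G : zmodType) (s : seq G) ms ms' :
  zs_split s (ms ++ ms') -> exists s1 s2,
  [/\ perm_eq (s1 ++ s2) s, zs_split s1 ms & zs_split s2 ms'].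
Proof.
move=> [ps ps_s [ps_m ps0]].
have: exists ps1 ps2, [/\ perm_eq (ps1 ++ ps2) ps, perm_eq (map size ps1) ms
    & perm_eq (map size ps2) ms'].
  move: ps_m; rewrite perm_sym => /(perm_iotaP 0%N)[Is pI eI].
  have sI : (size ms <= size Is)%N.
    by rewrite -(size_map (nth 0%N (map size ps)) Is) -eI size_cat leq_addr.
  pose f := fun i => nth [::] ps i.
  have eIf : map (nth 0%N [seq size i | i <- ps]) Is = map size (map f Is).
    rewrite -map_comp; apply/eq_in_map => i; rewrite (perm_mem pI) mem_iota.
    by rewrite /= add0n size_map => lt; rewrite (nth_map [::]).
  exists (map f (take (size ms) Is)), (map f (drop (size ms) Is)).
  rewrite -map_cat cat_take_drop; split.
  - have e : ps = map f (iota 0 (size ps)) by rewrite -/(mkseq _ _) mkseq_nth.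
    by rewrite [X in perm_eq _ X]e; apply: perm_map; rewrite size_map in pI.
  - by rewrite map_take map_take -eIf -eI take_size_cat.
  - by rewrite map_drop map_drop -eIf -eI drop_size_cat.
move=> [ps1 [ps2 [e m1 m2]]]; exists (flatten ps1), (flatten ps2).
move: ps0; rewrite -(perm_all _ e) all_cat => /andP[z1 z2].
split; [|by exists ps1|by exists ps2].
by rewrite -flatten_cat; apply: perm_trans ps_s; apply: perm_flatten.
Qed.

Lemma zs_split1 (G : zmodType) (s : seq G) :
  \sum_(x <- s) x = 0 -> zs_split s [:: size s].
Proof.
move=> s0; exists [:: s]; first by rewrite /= cats0.
by rewrite /= s0 eqxx.
Qed.

Lemma zs_split_size (G : zmodType) (s : seq G) ms : zs_split s ms -> sumn ms = size s.
Proof.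
move=> [ps ps_s [ps_m _]].
by rewrite -(perm_size ps_s) size_flatten /shape; apply/esym/perm_sumn.
Qed.

Lemma zs_split_merge (G : zmodType) (s : seq G) ms :
  zs_split s ms -> zs_split s [:: sumn ms].
Proof.
move=> zs; rewrite (zs_split_size zs); case: zs => ps ps_s [_ ps0].
apply: zs_split1; rewrite -(perm_big _ ps_s) /= big_flatten /=.
by rewrite big_seq big1 // => p pps; apply/eqP; apply: (allP ps0).
Qed.

Lemma zs_split_nseq (G : zmodType) (qs : seq (seq G)) n :
  (forall q, q \in qs -> size q = n /\ \sum_(x <- q) x = 0) ->
  zs_split (flatten qs) (nseq (size qs) n).
Proof.
move=> h; exists qs => //; split.
  suff -> : map size qs = nseq (size qs) n by [].
  rewrite -(size_map size qs); apply/all_pred1P/allP => i /mapP[q /h[sq _] ->].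
  by rewrite /= sq.
by apply/allP=> q /h[_ /= ->].
Qed.

(** * Merging blocks into larger blocks *)

(** The intended relation is that [ys] arises from [xs] by merging sizes. Stating it by its effect
    on splittings makes transitivity immediate. *)
Definition coarsens (xs ys : seq nat) : Prop :=
  forall (G : zmodType) (s : seq G), zs_split s xs -> zs_split s ys.

Lemma coarsens_cat xs ys xs' ys' :
  coarsens xs ys -> coarsens xs' ys' -> coarsens (xs ++ xs') (ys ++ ys').
Proof.
move=> h h' G s /zs_split_uncat[s1 [s2 [e z1 z2]]].
apply: zs_split_perm e (perm_refl _) _; apply: zs_split_cat; [exact: h|exact: h'].
Qed.

Lemma coarsens_perm xs ys : perm_eq xs ys -> coarsens xs ys.
Proof. by move=> e G s; apply: zs_split_perm. Qed.

Lemma coarsens_trans ys xs zs : coarsens xs ys -> coarsens ys zs -> coarsens xs zs.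
Proof. by move=> h h' G s /h/h'. Qed.

Lemma coarsens_sumn xs : coarsens xs [:: sumn xs].
Proof. by move=> G s; apply: zs_split_merge. Qed.

Lemma coarsens_cons (xs ys us vs : seq nat) y :
  perm_eq xs (us ++ vs) -> sumn us = y -> coarsens vs ys -> coarsens xs (y :: ys).
Proof.
move=> e <- h; apply: coarsens_trans (coarsens_perm e) _.
rewrite -cat1s; apply: coarsens_cat h; exact: coarsens_sumn.
Qed.

(** A part of size at least 8 gives off a part of size 4 and keeps at least 4; repeating this ends
    with sizes 4 to 7. *)
Lemma coarsens_4to7 (ms : seq nat) : all (leq 4) ms ->
  exists ms', [/\ all (fun m => 4 <= m <= 7)%N ms', sumn ms' = sumn ms & coarsens ms' ms].
Proof.
elim: ms => [|m ms IH] /=; first by exists [::]; split.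
move=> /andP[m4 /IH[ms' [a4 e c]]].
suff [us aus eus] : exists2 us, all (fun m => 4 <= m <= 7)%N us & sumn us = m.
  exists (us ++ ms'); split; [by rewrite all_cat aus|by rewrite sumn_cat e eus|].
  exact: coarsens_cons (perm_refl _) eus c.
elim/ltn_ind: m m4 => m IHm m4; have [m7|m8] := leqP m 7.
  by exists [:: m]; rewrite /= ?addn0 ?m4 ?m7.
have [|| us aus eus] := IHm (m - 4)%N; [lia|lia|].
by exists (4%N :: us); [rewrite /= aus | rewrite /= eus; lia].
Qed.

(** Greedy choice, part by part: a part equal to 5 takes a 5-block and any other part a 4-block, as
    long as there are some; an odd part without a 5-block takes a triple; pairs fill the rest. *)
Lemma coarsens_from_2345 (ms : seq nat) (q f o p : nat) :
  all (fun m => 4 <= m <= 7)%N ms ->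
  (q <= count (predC1 5) ms)%N -> (f <= count (pred1 5) ms)%N ->
  (o + f = count odd ms)%N -> (4 * q + 5 * f + 3 * o + 2 * p = sumn ms)%N ->
  coarsens (nseq q 4 ++ nseq f 5 ++ nseq o 3 ++ nseq p 2) ms.
Proof.
elim: ms q f o p => [|m ms IH] q f o p /=.
  move=> _ ? ? ? ?; have [-> -> -> ->] : [/\ q = 0, f = 0, o = 0 & p = 0]%N by split; lia.
  by [].
move=> /andP[m47 a47] hq hf ho hs.
(* The blocks of size 3, 4 and 5 kept for the later parts fit into those parts, so the total sum
   leaves enough pairs for the current one. *)
have bound : (4 * count (predC1 5) ms + 3 * count (pred1 7) ms + 5 * count (pred1 5) ms <= sumn ms)%N.
  elim: (ms) a47 => //= n ns IHn /andP[n47 /IHn]; lia.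
have odds : (count odd ms = count (pred1 7) ms + count (pred1 5) ms)%N.
  elim: (ms) a47 => //= n ns IHn /andP[n47 /IHn ->].
  by case: n n47 => [|[|[|[|[|[|[|[|n]]]]]]]] //= _; lia.
set c5' := count (predC1 5) ms in hq bound *; set c5 := count (pred1 5) ms in hf bound odds *.
set c7 := count (pred1 7) ms in bound odds *; set co := count odd ms in ho odds *.
set S := sumn ms in hs bound *.
have step q' f' o' p' us : [/\ q = q' + count (pred1 4) us,
    f = f' + count (pred1 5) us, o = o' + count (pred1 3) us &
    p = p' + count (pred1 2) us]%N -> sumn us = m ->
    all (mem [:: 2; 3; 4; 5]%N) us ->
    [/\ q' <= c5', f' <= c5, o' + f' = co & 4 * q' + 5 * f' + 3 * o' + 2 * p' = S]%N ->
    coarsens (nseq q 4 ++ nseq f 5 ++ nseq o 3 ++ nseq p 2) (m :: ms).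
  move=> [eq ef eo ep] eus aus [h1 h2 h3 h4].
  apply: (coarsens_cons (us := us)) eus (IH _ _ _ _ a47 h1 h2 h3 h4).
  apply/permP => a; rewrite eq ef eo ep !count_cat !count_nseq.
  have -> : count a us = (a 4 * count (pred1 4) us + a 5 * count (pred1 5) us +
      a 3 * count (pred1 3) us + a 2 * count (pred1 2) us)%N.
    elim: (us) aus => [|x xs IHx] /=; first by rewrite !muln0.
    move=> /andP[]; rewrite !inE => hx /IHx ->.
    by case/or4P: hx => /eqP ->; rewrite /= !mulnDr !muln0 !muln1; ring.
  by rewrite !mulnDr; ring.
have {m47} : m \in [:: 4; 5; 6; 7]%N by rewrite !inE; clear -m47; lia.
move: hq hf ho hs; rewrite !inE.
clearbody c5' c5 c7 co S => + + + + /or4P[] /eqP em; rewrite {}em in step *; rewrite /= => hq hf ho hs.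
- case: q hq hs step => [|q] hq hs step.
    by apply: (step 0 f o (p - 2) [:: 2; 2])%N => //; clear -hq hf ho hs bound odds; split=> /=; lia.
  by apply: (step q f o p [:: 4])%N => //; clear -hq hf ho hs bound odds; split=> /=; lia.
- case: f hf ho hs step => [|f] hf ho hs step.
    by apply: (step q 0 (o - 1) (p - 1) [:: 3; 2])%N => //; clear -hq hf ho hs bound odds; split=> /=; lia.
  by apply: (step q f o p [:: 5])%N => //; clear -hq hf ho hs bound odds; split=> /=; lia.
- case: q hq hs step => [|q] hq hs step.
    by apply: (step 0 f o (p - 3) [:: 2; 2; 2])%N => //; clear -hq hf ho hs bound odds; split=> /=; lia.
  by apply: (step q f o (p - 1) [:: 4; 2])%N => //; clear -hq hf ho hs bound odds; split=> /=; lia.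
- case: q hq hs step => [|q] hq hs step.
    by apply: (step 0 f (o - 1) (p - 2) [:: 3; 2; 2])%N => //; clear -hq hf ho hs bound odds; split=> /=; lia.
  by apply: (step q f (o - 1) p [:: 4; 3])%N => //; clear -hq hf ho hs bound odds; split=> /=; lia.
Qed.

(** * Transport along morphisms and passage to set partitions *)

Lemma zs_split_map (G G' : zmodType) (f : G -> G') (s : seq G) ms :
  {morph f : x y / x + y} -> zs_split s ms -> zs_split (map f s) ms.
Proof.
move=> fD [ps ps_s [ps_m ps0]].
have f0 : f 0 = 0 by apply: (addrI (f 0)); rewrite -fD !addr0.
exists (map (map f) ps); first by rewrite -map_flatten; apply: perm_map.
rewrite -map_comp (eq_map (g := size)); last by move=> p; apply: size_map.
split=> //; rewrite all_map; apply: sub_all ps0 => p /= /eqP e.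
by rewrite big_map -(big_morph f fD f0) e f0.
Qed.

(** Blocks and sizes agree only up to permutation: entry [i] of [Is] is the number of the block to
    be used as [S i]. The blocks are disjoint because their concatenation has no repetition. *)
Lemma ZSPP_of_zs_split (G : finZmodType) k :
  (forall ms, all (leq k) ms -> sumn ms = #|G|.-1 ->
     zs_split (enum [set~ (0 : G)]) ms) -> ZSPP k G.
Proof.
move=> h t m _ _ hk hs.
have [||ps ps_s [ps_m ps0]] := h (map m (enum 'I_t)).
- by apply/allP => _ /mapP[i _ ->].
- by rewrite sumnE big_map big_enum.
move: ps_m; rewrite perm_sym => /(perm_iotaP 0%N)[Is pI eI].
have szI : size Is = t by have := congr1 size eI; rewrite 2!size_map size_enum_ord.
rewrite size_map in pI.
have ltI (i : 'I_t) : (nth 0%N Is i < size ps)%N.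
  have := mem_nth 0%N (_ : (i < size Is)%N); rewrite szI => /(_ (ltn_ord i)).
  by rewrite (perm_mem pI) mem_iota.
have uf : uniq (flatten ps) by rewrite (perm_uniq ps_s) enum_uniq.
have memP p x : p \in ps -> x \in p -> x != 0.
  move=> pps xp; suff : x \in enum [set~ (0 : G)] by rewrite mem_enum !inE.
  by rewrite -(perm_mem ps_s); apply/flattenP; exists p.
have uP : forall i j, (i < size ps)%N -> (j < size ps)%N -> forall x,
    x \in nth [::] ps i -> x \in nth [::] ps j -> i = j.
  elim: (ps) uf => [|p qs IHq] //=; rewrite cat_uniq => /and3P[_ /hasPn h2 h3].
  have bad j x : (j < size qs)%N -> x \in p -> x \in nth [::] qs j -> False.
    move=> lj xp xq; have /h2 : x \in flatten qs.
      by apply/flattenP; exists (nth [::] qs j) => //; apply: mem_nth.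
    by rewrite /= xp.
  case=> [|i] [|j] //= li lj x xi xj; [by case: (bad j x)|by case: (bad i x)|].
  by congr S; apply: IHq xj.
pose S (i : 'I_t) := [set x in nth [::] ps (nth 0%N Is i)].
have uS (i : 'I_t) : uniq (nth [::] ps (nth 0%N Is i)).
  elim: (ps) (nth 0%N Is i) uf => [|p qs IHq] [|j] //=; rewrite cat_uniq => /and3P[] //.
  by move=> _ _ /IHq.
exists S; split.
- move=> i j nij; rewrite -setI_eq0; apply/eqP/setP => x; rewrite !inE.
  apply/negP => /andP[xi xj]; case/eqP: nij; apply: val_inj => /=.
  have := uP _ _ (ltI i) (ltI j) _ xi xj => /eqP.
  by rewrite nth_uniq ?szI ?(perm_uniq pI) ?iota_uniq // => /eqP.
- apply/setP => x; rewrite !inE; apply/bigcupP/idP => [[i _]|x0].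
    by rewrite inE; apply: memP; apply: mem_nth.
  have : x \in flatten ps by rewrite (perm_mem ps_s) mem_enum !inE.
  case/flattenP => p pps xp; have ip : (index p ps < size ps)%N by rewrite index_mem.
  have iI : index p ps \in Is by rewrite (perm_mem pI) mem_iota.
  have lt : (index (index p ps) Is < t)%N by rewrite -szI index_mem.
  by exists (Ordinal lt) => //; rewrite inE /= nth_index // nth_index.
- move=> i; rewrite cardsE (card_uniqP (uS i)).
  have := congr1 (nth 0%N ^~ i) eI; rewrite (nth_map i) ?size_enum_ord //.
  rewrite nth_ord_enum => ->; rewrite (nth_map 0%N) ?szI //.
  by rewrite (nth_map [::]).
- move=> i; rewrite -big_enum /=; apply/eqP.
  rewrite (perm_big (nth [::] ps (nth 0%N Is i))) /=; last first.
    by apply: uniq_perm; rewrite ?enum_uniq // => x; rewrite mem_enum inE.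
  by apply: (allP ps0); apply: mem_nth.
Qed.

(** * Duplicate-free concatenations and opposite pairs *)

Lemma uniq_flatten_map (T1 T2 : eqType) (F : T1 -> seq T2) (s : seq T1) :
  uniq s -> {in s, forall t, uniq (F t)} ->
  {in s &, forall t t' x, x \in F t -> x \in F t' -> t = t'} ->
  uniq (flatten (map F s)).
Proof.
elim: s => //= t s IH /andP[ts us] uF inj; rewrite cat_uniq uF ?mem_head //=.
rewrite IH // => [|t1 t1s|t1 t2 t1s t2s]; last 2 first.
- by apply: uF; rewrite inE t1s orbT.
- by apply: inj; rewrite inE ?t1s ?t2s orbT.
rewrite andbT; apply/hasPn => x /flattenP[_ /mapP[t' t's ->] xt'].
apply: contra ts => xt; suff -> : t = t' by [].
by apply: inj xt xt'; rewrite inE ?eqxx ?t's ?orbT.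
Qed.

Lemma perm_opp_halves (G : zmodType) (s : seq G) :
  uniq s -> {in s, forall x, - x \in s} -> {in s, forall x, - x != x} ->
  exists xs, perm_eq s (xs ++ map -%R xs).
Proof.
elim/ltn_ind: {s}(size s) {-2}s (erefl (size s)) => n IH [|x s] sz.
  by exists [::].
move=> us cl nf; have xs := mem_head x s.
have nxs : - x \in s.
  by have := cl _ xs; rewrite inE (negbTE (nf _ xs)).
have /= /andP[xNs us'] := us.
have e := perm_to_rem nxs.
have us2 : uniq (rem (- x) s) by rewrite rem_uniq.
have memr y : (y \in rem (- x) s) = (y != - x) && (y \in s) by rewrite mem_rem_uniq.
have [||||xs' e'] := IH (size (rem (- x) s)) _ (rem (- x) s) erefl.
- by rewrite -sz /= ltnS size_rem // leq_pred.
- by [].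
- move=> y; rewrite !memr => /andP[yx ys]; rewrite eqr_opp.
  have yx' : y != x by apply: contraNneq xNs => <-.
  rewrite yx' /=; have := cl y; rewrite !inE ys orbT => /(_ isT).
  by rewrite eqr_oppLR (negbTE yx).
- by move=> y; rewrite memr => /andP[_ ys]; apply: nf; rewrite inE ys orbT.
exists (x :: xs'); rewrite /= perm_cons (perm_trans e) //.
by rewrite perm_sym -[_ :: map _ _]cat1s perm_catCA /= perm_cons perm_sym.
Qed.

Lemma zs_split_opp_closed (G : zmodType) (s : seq G) :
  uniq s -> {in s, forall x, - x \in s} -> {in s, forall x, - x != x} ->
  zs_split s (nseq (size s)./2 2).
Proof.
move=> us cl nf; have [xs e] := perm_opp_halves us cl nf.
have -> : (size s)./2 = size [seq [:: x; - x] | x <- xs].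
  by rewrite (perm_size e) size_cat !size_map addnn doubleK.
apply: zs_split_perm (perm_refl _) (zs_split_nseq _).
  rewrite perm_sym (perm_trans e) //.
  elim: (xs) => //= x ys IH; rewrite perm_cons.
  by rewrite -[_ :: map _ _]cat1s perm_catCA /= perm_cons.
move=> _ /mapP[x _ ->]; split=> //.
by rewrite big_cons big_seq1 subrr.
Qed.

(** * Subgroups and transversals *)

Lemma zmod_closed_opp_in (L : zmodType) (N : {pred L}) x :
  zmod_closed N -> x \in N -> - x \in N.
Proof. by move=> [N0 NB] xN; rewrite -sub0r NB. Qed.

Lemma zmod_closed_add_in (L : zmodType) (N : {pred L}) x y :
  zmod_closed N -> x \in N -> y \in N -> x + y \in N.
Proof. by move=> hN xN yN; rewrite -(opprK y) hN.2 ?zmod_closed_opp_in. Qed.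

(** Here [A] is a union of cosets of [N]; the coset of one element is removed, and what is left is
    again such a union. *)
Lemma transversal_mod (L : finZmodType) (N A : {set L}) : zmod_closed N ->
  (forall a n, a \in A -> n \in N -> a + n \in A) ->
  exists rs : seq L,
    [/\ uniq rs, {subset rs <= A},
        forall a, a \in A -> exists2 r, r \in rs & a - r \in N,
        {in rs &, forall r r', r - r' \in N -> r = r'} &
        (size rs * #|N|)%N = #|A|].
Proof.
move=> hN; elim/ltn_ind: {A}#|A| {-2}A (erefl #|A|) => n IH A sz clA.
have [->|/set0Pn[a aA]] := eqVneq A set0.
  by exists [::]; split=> //= [a|]; rewrite ?inE ?mul0n ?cards0.
pose B := [set a + n | n in N].
have memB x : (x \in B) = (x - a \in N).
  apply/imsetP/idP => [[y yN ->]|xa]; first by rewrite addrC addKr.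
  by exists (x - a) => //; rewrite addrC subrK.
have BA : B \subset A by apply/subsetP=> _ /imsetP[y yN ->]; apply: clA.
have cB : #|B| = #|N| by apply: card_imset; apply: addrI.
have N0 : (0 < #|N|)%N by apply/card_gt0P; exists 0; case: hN.
have cAB : (#|A :\: B| + #|N| = #|A|)%N.
  by rewrite -cB -(cardsID B A) (setIidPr BA) addnC.
have [||rs [u1 s1 ex1 in1 c1]] := IH #|A :\: B| _ (A :\: B) erefl; first by lia.
  move=> x y; rewrite !inE !memB => /andP[xB xA] yN; rewrite clA // andbT.
  apply: contra xB => h.
  by have := hN.2 _ _ h yN; rewrite addrAC addrK.
exists (a :: rs); split=> /=.
- rewrite u1 andbT; apply/negP => /s1; rewrite !inE memB subrr.
  by case: hN => ->.
- by move=> x; rewrite inE => /predU1P[-> //|/s1]; rewrite inE => /andP[].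
- move=> x xA; have [xB|xB] := boolP (x \in B).
    by exists a; rewrite ?mem_head // -memB.
  have [|r rr xr] := ex1 x; first by rewrite inE xB.
  by exists r; rewrite // inE rr orbT.
- have sep r : r \in rs -> r - a \notin N by move/s1; rewrite !inE memB => /andP[].
  move=> r r'; rewrite !inE => /predU1P[->|rr] /predU1P[->|rr'] //.
  + by move/(zmod_closed_opp_in hN); rewrite opprB (negbTE (sep _ rr')).
  + by rewrite (negbTE (sep _ rr)).
  + exact: in1.
- by rewrite mulSn c1 addnC.
Qed.

(* The reflexive tactic zmod proves identities in abelian groups by comparing the
   integer coefficients of the atoms on both sides; ring only handles rings. *)
Inductive zexp := ZVar of nat | ZZero | ZAdd of zexp & zexp | ZOpp of zexp.

Fixpoint zeval (V : zmodType) (env : seq V) (e : zexp) : V :=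
  match e with
  | ZVar n => nth 0 env n
  | ZZero => 0
  | ZAdd a b => zeval env a + zeval env b
  | ZOpp a => - zeval env a
  end.

Fixpoint zcoef (e : zexp) (i : nat) : int :=
  match e with
  | ZVar n => (i == n)%:Z
  | ZZero => 0
  | ZAdd a b => zcoef a i + zcoef b i
  | ZOpp a => - zcoef a i
  end.

Lemma zevalE (V : zmodType) (env : seq V) e :
  zeval env e = \sum_(i < size env) env`_i *~ zcoef e i.
Proof.
elim: e => [n||a IHa b IHb|a IHa] /=; rewrite ?IHa ?IHb.
- have [lt|ge] := ltnP n (size env).
    rewrite (bigD1 (Ordinal lt)) //= eqxx mulr1z big1 ?addr0 // => i ni.
    by rewrite (_ : (_ == _) = false) ?mulr0z //; apply/negbTE.
  rewrite nth_default // big1 // => i _.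
  by rewrite (ltn_eqF (leq_trans (ltn_ord i) ge)) mulr0z.
- by rewrite big1.
- by rewrite -big_split; apply: eq_bigr => i _; rewrite mulrzDr.
- by rewrite -sumrN; apply: eq_bigr => i _; rewrite mulrNz.
Qed.

Lemma zeval_eq (V : zmodType) (env : seq V) e1 e2 :
  all (fun i => zcoef e1 i == zcoef e2 i) (iota 0 (size env)) ->
  zeval env e1 = zeval env e2.
Proof.
move=> /allP h; rewrite !zevalE; apply: eq_bigr => i _.
by rewrite (eqP (h i _)) // mem_iota ltn_ord.
Qed.

Ltac zmod_index x l :=
  match l with
  | ?y :: _ => let _ := match goal with _ => unify x y end in constr:(0%N)
  | _ :: ?l' => let n := zmod_index x l' in constr:(S n)
  end.
Ltac zmod_atoms l t :=
  match t with
  | (?a + ?b) => let l := zmod_atoms l a in zmod_atoms l b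
  | (- ?a) => zmod_atoms l a
  | 0 => l
  | _ => match l with
         | _ => let _ := zmod_index t l in l
         | _ => constr:(t :: l)
         end
  end.
Ltac zmod_reify l t :=
  match t with
  | (?a + ?b) =>
      let a := zmod_reify l a in let b := zmod_reify l b in constr:(ZAdd a b)
  | (- ?a) => let a := zmod_reify l a in constr:(ZOpp a)
  | 0 => constr:(ZZero)
  | _ => let n := zmod_index t l in constr:(ZVar n)
  end.
Ltac zmod :=
  intros; rewrite ?mulr2n;
  match goal with
  | |- @eq ?V ?s ?t =>
      let l := zmod_atoms (@nil V) s in
      let l := zmod_atoms l t in
      let a := zmod_reify l s in
      let b := zmod_reify l t in
      apply: (@zeval_eq _ l a b); vm_compute; reflexivity
  end.

(** * Orders, doubling and extensions of index 2 *)

(** Translation by [x] permutes [L], hence leaves the sum of all elements unchanged. *)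
Lemma mulrn_card (L : finZmodType) (x : L) : x *+ #|L| = 0.
Proof.
have e : \sum_(y : L) y = \sum_(y : L) (x + y).
  by rewrite (reindex_inj (addrI x)).
move: e; rewrite big_split /= sumr_const => /eqP.
by rewrite -[X in X == _]add0r (inj_eq (addIr _)) => /eqP.
Qed.

Lemma card_zmod_dvdn (L : finZmodType) (N : {set L}) :
  zmod_closed N -> (#|N| %| #|L|)%N.
Proof.
move=> hN; have [|rs [_ _ _ _ c]] := transversal_mod (A := setT) hN.
  by move=> *; rewrite inE.
by rewrite -cardsT -c dvdn_mull.
Qed.

(** Repeated doubling takes [x] to 0, the order of [L] being a power of 2. The multiple just before
    the first one in [N] is an involution modulo [N]. *)
Lemma double_into (L : finZmodType) (N : {set L}) eta x :
  #|L| = (2 ^ eta)%N -> zmod_closed N -> x \notin N ->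
  exists2 j, x *+ 2 ^ j \notin N & x *+ 2 ^ j + x *+ 2 ^ j \in N.
Proof.
move=> cL hN xN; have ex : exists j, x *+ 2 ^ j \in N.
  by exists eta; rewrite -cL mulrn_card; case: hN.
case: (ex_minnP ex) => [[|j] jN jmin]; first by rewrite mulr1n (negbTE xN) in jN.
exists j; last by rewrite -mulr2n -mulrnA -expnSr.
by apply/negP => /jmin; rewrite ltnn.
Qed.

(** If [N] is a subgroup containing [u + u], this is the subgroup generated by [N] and [u]. *)
Definition adjoin (L : finZmodType) (N : {set L}) u : {set L} :=
  [set x | (x \in N) || (x - u \in N)].

Lemma adjoin_zmod_closed (L : finZmodType) (N : {set L}) u :
  zmod_closed N -> u + u \in N -> zmod_closed (adjoin N u).
Proof.
move=> hN u2; split; first by rewrite inE; case: hN => ->.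
move=> x y; rewrite !inE => /orP[xN|xN] /orP[yN|yN].
- by rewrite hN.2.
- have := hN.2 _ _ (hN.2 _ _ xN yN) u2; rewrite (_ : _ - _ - _ = x - y - u) => [->|].
    by rewrite orbT.
  zmod.
- by rewrite addrAC (hN.2 _ _ xN yN) orbT.
- by have := hN.2 _ _ xN yN; rewrite opprB addrA subrK => ->.
Qed.

Lemma sub_adjoin (L : finZmodType) (N : {set L}) u : {subset N <= adjoin N u}.
Proof. by move=> x xN; rewrite inE xN. Qed.

Lemma adjoin_gen (L : finZmodType) (N : {set L}) u : zmod_closed N -> u \in adjoin N u.
Proof. by move=> hN; rewrite inE subrr hN.1 orbT. Qed.

Lemma card_adjoin (L : finZmodType) (N : {set L}) u :
  zmod_closed N -> u \notin N -> #|adjoin N u| = (2 * #|N|)%N.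
Proof.
move=> hN uN.
have -> : adjoin N u = N :|: [set n + u | n in N].
  apply/setP => x; rewrite !inE; congr (_ || _); apply/idP/imsetP => [xu|[n nN ->]].
    by exists (x - u); rewrite // subrK.
  by rewrite addrK.
rewrite cardsU card_imset; last exact: addIr.
rewrite (_ : _ :&: _ = set0) ?cards0 ?subn0 ?mul2n ?addnn //.
apply/setP => x; rewrite !inE; apply/negP => /andP[xN /imsetP[n nN ex]].
by case/negP: uN; have := hN.2 _ _ xN nN; rewrite ex addrAC subrr add0r.
Qed.

(** If [x + x] were outside [M], then [M] and [M + x] would be disjoint and both miss [x + x], so
    that [L] would have more than [2 * #|M|] elements. *)
Lemma double_index2 (L : finZmodType) (M : {set L}) :
  zmod_closed M -> (#|L| <= 2 * #|M|)%N -> forall x, x + x \in M.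
Proof.
move=> hM cM x; have [xM|xM] := boolP (x \in M); first exact: zmod_closed_add_in.
apply/negPn/negP => x2.
have dis : [disjoint M & [set y + x | y in M]].
  rewrite -setI_eq0; apply/eqP/setP => z; rewrite !inE; apply/negP => /andP[zM /imsetP[n nM ez]].
  by case/negP: xM; have := hM.2 _ _ zM nM; rewrite ez addrAC subrr add0r.
have sub : (M :|: [set y + x | y in M]) \subset [set~ x + x].
  apply/subsetP => z; rewrite !inE => /orP[zM|/imsetP[n nM ->]].
    by apply: contraNneq x2 => <-.
  by apply: contra xM => /eqP/addIr <-.
have h : (#|M| + #|M| <= #|L|.-1)%N.
  rewrite -(cardsC1 (x + x)); apply: leq_trans (subset_leq_card sub).
  rewrite cardsU (eqP (_ : _ :&: _ == set0)) ?setI_eq0 // cards0 subn0.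
  by rewrite card_imset //; apply: addIr.
have L0 : (0 < #|L|)%N by apply/card_gt0P; exists 0.
lia.
Qed.

(** * Configurations of pairs modulo a subgroup: direct constructions *)

(* A family of pairs for each of three colours, to be read modulo the subgroup N;
   it is built by lifting from L modulo a larger subgroup. *)
Definition config (L : finZmodType) (N : {set L}) (D : 'I_3 -> seq (L * L)) : Prop :=
  [/\ forall i, (#|L| <= 4 * size (D i) * #|N|)%N,
      forall i, uniq (D i),
      forall i, {in D i &, forall p q : L * L,
        [/\ p.1 - q.1 \in N -> p = q, p.2 - q.2 \in N -> p = q,
            p.1 + p.2 - (q.1 + q.2) \in N -> p = q & p.1 - q.2 \notin N]} &
      forall i j, i != j -> forall p q, p \in D i -> q \in D j ->
        [/\ p.1 + p.2 - q.1 \notin N, p.1 + p.2 + q.1 \notin N,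
            p.1 + p.2 - q.2 \notin N & p.1 + p.2 + q.2 \notin N]].

(** The members [r] and [r + w] lie outside [M], the sums [r + r + w] inside, so one family serves
    all three colours. Within a colour, [adjoin N w] separates the members and the doubles separate
    the sums. *)
Lemma config_shift (L : finZmodType) (N M : {set L}) (rs : seq L) w :
  zmod_closed N -> zmod_closed M -> {subset N <= M} -> (forall x, x + x \in M) ->
  w \in M -> w \notin N -> uniq rs -> {in rs, forall r, r \notin M} ->
  {in rs &, forall r r', r - r' \in adjoin N w -> r = r'} ->
  {in rs &, forall r r', (r + r) - (r' + r') \in N -> r = r'} ->
  (#|L| <= 4 * size rs * #|N|)%N ->
  config N (fun _ => [seq (r, r + w) | r <- rs]).
Proof.
move=> hN hM NM M2 wM wN urs rsM inj1 inj2 szrs; split.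
- by move=> i; rewrite size_map.
- by move=> i; rewrite map_inj_uniq // => x y [].
- move=> i _ _ /mapP[r rr ->] /mapP[r' rr' ->] /=; split.
  + by move=> h; rewrite (inj1 r r') ?sub_adjoin.
  + rewrite (_ : r + w - (r' + w) = r - r'); last by zmod.
    by move=> h; rewrite (inj1 r r') ?sub_adjoin.
  + rewrite (_ : _ - _ = r + r - (r' + r')); last by zmod.
    by move=> h; rewrite (inj2 r r').
  + apply: contra wN => h; have e : r = r'.
      apply: inj1 => //; rewrite inE; apply/orP; right.
      have -> : r - r' - w = r - (r' + w) by zmod.
      exact: h.
    by move: h; rewrite e opprD addNKr => /(zmod_closed_opp_in hN); rewrite opprK.
- move=> i j _ _ _ /mapP[r rr ->] /mapP[r' rr' ->] /=.
  have sM : r + (r + w) \in M by rewrite addrA zmod_closed_add_in.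
  have r'M := rsM _ rr'.
  have rwM : r' + w \notin M by apply: contra r'M => h; rewrite -(addrK w r') hM.2.
  have key x : x \notin M -> (r + (r + w) - x \notin N) /\ (r + (r + w) + x \notin N).
    move=> xM; split; apply: contra xM => /NM h.
      by rewrite -(subKr (r + (r + w)) x) hM.2.
    by rewrite -(addKr (r + (r + w)) x) addrC hM.2.
  by have [? ?] := key _ r'M; have [? ?] := key _ rwM.
Qed.

Lemma exists_notin (L : finZmodType) (A : {set L}) :
  (#|A| < #|L|)%N -> exists x, x \notin A.
Proof.
rewrite ltnNge -cardsT => h; have /subsetPn[x _ xA] : ~~ ([set: L] \subset A).
  by apply: contra h => /subset_leq_card.
by exists x.
Qed.

(* The pairs are {l, l + u} with l outside M = 2L + N: their sums 2l + u lie in M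
   and determine l modulo u, as u is the only involution modulo N. *)
Lemma config_unique_involution (L : finZmodType) (N : {set L}) eta u :
  #|L| = (2 ^ eta)%N -> zmod_closed N -> (4 * #|N| <= #|L|)%N ->
  u \notin N -> u + u \in N ->
  (forall x, x + x \in N -> x \in adjoin N u) ->
  exists D, config N D.
Proof.
move=> cL hN cN uN u2 uniq_u.
pose T := adjoin N u; have hT : zmod_closed T by apply: adjoin_zmod_closed.
have cT : #|T| = (2 * #|N|)%N by apply: card_adjoin.
pose M : {set L} := [set y + y + n | y in L, n in N].
have memM x : reflect (exists y, x - (y + y) \in N) (x \in M).
  apply: (iffP imset2P) => [[y n _ nN ->]|[y xy]].
    by exists y; rewrite addrAC subrr add0r.
  by exists y (x - (y + y)) => //; zmod.
have NM : {subset N <= M}.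
  by move=> n nN; apply/memM; exists 0; rewrite addr0 subr0.
have M2 x : x + x \in M by apply/memM; exists x; rewrite subrr; case: hN.
have hM : zmod_closed M.
  split; first by apply: NM; case: hN.
  move=> x y /memM[x' xx] /memM[y' yy]; apply/memM; exists (x' - y').
  have -> : x - y - (x' - y' + (x' - y')) = x - (x' + x') - (y - (y' + y')) by zmod.
  exact: hN.2.
(* Some double [x + x] is outside [N]. Doubling it further gives an involution modulo [N], which is
   congruent to [u] by uniqueness and is a multiple of a double. *)
have uM : u \in M.
  have [x x2N] : exists x, x + x \notin N.
    have [|x xT] := @exists_notin L T.
      have : (0 < #|N|)%N by apply/card_gt0P; exists 0; case: hN.
      by rewrite cT; lia.
    by exists x; apply: contra xT; apply: uniq_u.
  have [j jN j2] := double_into cL hN x2N.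
  have := uniq_u _ j2; rewrite inE (negbTE jN) /= => /NM h.
  have jM : (x + x) *+ 2 ^ j \in M.
    by elim: (2 ^ j)%N => [|k IH]; rewrite ?mulr0n ?mulrSr; [case: hM|apply: zmod_closed_add_in].
  by rewrite -(subKr ((x + x) *+ 2 ^ j) u); apply: hM.2.
have TM : {subset T <= M}.
  move=> x; rewrite inE => /orP[/NM//|/NM h].
  by rewrite -(subrK u x); apply: zmod_closed_add_in.
(* Modulo [N], doubling is constant on cosets of [T], so [M] consists of at most [#|L| / #|T|]
   cosets of [N]; this is half of [L]. *)
have cM : (2 * #|M| <= #|L|)%N.
  have [|rs [urs _ ex _ szrs]] := transversal_mod (A := setT) hT.
    by move=> *; rewrite inE.
  have : (#|M| <= size rs * #|N|)%N.
    have <- : #|[set r in rs]| = size rs by rewrite cardsE (card_uniqP urs).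
    rewrite -cardsX; set B := setX _ _.
    apply: leq_trans (leq_imset_card (fun p : L * L => p.1 + p.1 + p.2) B).
    apply/subset_leq_card/subsetP => x /memM[y xy]; have [|r rr yr] := ex y.
      by rewrite inE.
    apply/imsetP; exists (r, x - (r + r)); last by rewrite /=; zmod.
    rewrite inE /= inE rr /=.
    have yr2 : (y - r) + (y - r) \in N.
      move: yr; rewrite inE => /orP[yr|yr]; first exact: zmod_closed_add_in.
      have -> : y - r + (y - r) = (y - r - u) + (y - r - u) + (u + u) by zmod.
      exact: (zmod_closed_add_in hN (zmod_closed_add_in hN yr yr) u2).
    have -> : x - (r + r) = x - (y + y) + (y - r + (y - r)) by zmod.
    exact: zmod_closed_add_in.
  rewrite -cardsT -szrs cT; lia.
have [|rs [urs srs _ inj szrs]] := transversal_mod (A := ~: M) hT.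
  move=> a n; rewrite !in_setC => aM nT; apply: contra aM => anM.
  by have := hM.2 _ _ anM (TM _ nT); rewrite addrK.
exists (fun _ => [seq (r, r + u) | r <- rs]); apply: (config_shift (M := M)) => //.
- by move=> r /srs; rewrite inE.
- move=> r r' rr rr' h; apply: inj => //; apply: uniq_u.
  by have -> : r - r' + (r - r') = r + r - (r' + r') by zmod.
- have cC : (#|M| + #|~: M| = #|L|)%N := cardsC M.
  have cP : (size rs * (2 * #|N|) = #|~: M|)%N by rewrite -cT.
  lia.
Qed.

(** One pair per colour is enough here, and [(u, v)] serves them all: its sum is the third
    involution of the Klein group modulo [N]. *)
Lemma config_klein (L : finZmodType) (N : {set L}) u v :
  zmod_closed N -> (#|L| <= 4 * #|N|)%N -> u + u \in N -> v + v \in N ->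
  u \notin N -> v \notin adjoin N u ->
  exists D, config N D.
Proof.
move=> hN cN u2 v2 uN; rewrite inE negb_or => /andP[vN vuN].
exists (fun _ => [:: (u, v)]); split => //=.
- by move=> _ p q; rewrite !inE => /eqP -> /eqP ->; split=> //=;
    apply: contra vuN => /(zmod_closed_opp_in hN); rewrite opprB.
- move=> _ _ _ p q; rewrite !inE => /eqP -> /eqP -> /=; split.
  + by have -> : u + v - u = v by zmod.
  + by apply: contra vN => h; have -> : v = u + v + u - (u + u); [zmod|apply: hN.2].
  + by have -> : u + v - v = u by zmod.
  + by apply: contra uN => h; have -> : u = u + v + v - (v + v); [zmod|apply: hN.2].
Qed.

(** Modulo [N], [y] has order 4 and generates a subgroup [M] of index 2. For [r] outside [M] the
    pairs are [r], [r + 2y] and [r + y], [r + 3y]; their sums differ by [2y]. *)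
Lemma config_order8_cyclic4 (L : finZmodType) (N : {set L}) y :
  zmod_closed N -> #|L| = (8 * #|N|)%N -> y + y \notin N -> (y + y) + (y + y) \in N ->
  exists D, config N D.
Proof.
move=> hN cL y2 y4.
have yN : y \notin N by apply: contra y2 => yN; apply: zmod_closed_add_in.
pose N' := adjoin N (y + y); have hN' : zmod_closed N' by apply: adjoin_zmod_closed.
have yN' : y \notin N'.
  rewrite inE negb_or yN; apply: contra yN => /(zmod_closed_opp_in hN).
  by have -> : - (y - (y + y)) = y by zmod.
pose M := adjoin N' y; have hM : zmod_closed M.
  by apply: adjoin_zmod_closed => //; apply: adjoin_gen.
have cM : (#|L| = 2 * #|M|)%N by rewrite cL !card_adjoin //; ring.
have N0 : (0 < #|N|)%N by apply/card_gt0P; exists 0; case: hN.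
have [r rM] : exists r, r \notin M by apply: exists_notin; lia.
have NM : {subset N <= M} by move=> x xN; do 2!apply: sub_adjoin.
have M2 : forall x, x + x \in M by apply: double_index2; rewrite ?cM.
have yM : y \in M by apply: adjoin_gen.
have ryM : r + y \notin M by apply: contra rM => h; rewrite -(addrK y r) hM.2.
have e1 : r - (r + y) = - y by zmod.
have e2 : r + y - r = y by zmod.
have mNy : - y \notin N' by apply: contra yN' => /(zmod_closed_opp_in hN'); rewrite opprK.
have nr : r != r + y.
  by apply: contraNneq yN => e; rewrite -e2 -e subrr; case: hN.
exists (fun _ => [seq (z, z + (y + y)) | z <- [:: r; r + y]]).
apply: (config_shift (M := M)) => //.
- by rewrite /= inE nr.
- by move=> z; rewrite mem_seq2 => /orP[] /eqP ->.
- move=> z z'; rewrite !mem_seq2 => /orP[] /eqP -> /orP[] /eqP -> //.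
  + by rewrite e1 -/N' (negbTE mNy).
  + by rewrite e2 -/N' (negbTE yN').
- move=> z z'; rewrite !mem_seq2 => /orP[] /eqP -> /orP[] /eqP -> //.
  + have -> : r + r - (r + y + (r + y)) = - (y + y) by zmod.
    by move/(zmod_closed_opp_in hN); rewrite opprK (negbTE y2).
  + have -> : r + y + (r + y) - (r + r) = y + y by zmod.
    by rewrite (negbTE y2).
- by rewrite cL; apply: leqnn.
Qed.

Definition xor3 (s t : bool * bool * bool) : bool * bool * bool :=
  (s.1.1 (+) t.1.1, s.1.2 (+) t.1.2, s.2 (+) t.2).

Definition bitsum (L : zmodType) (u v c : L) (t : bool * bool * bool) : L :=
  u *+ t.1.1 + v *+ t.1.2 + c *+ t.2.

(** [t] is a coordinate vector of [x] modulo [N] over the field with two elements; it turns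
    non-membership in [N] into a computation with bits. *)
Definition has_bits (L : finZmodType) (N : {set L}) (u v c x : L) t :=
  x - bitsum u v c t \in N.

Lemma has_bitsD (L : finZmodType) (N : {set L}) (u v c x y : L) s t :
  zmod_closed N -> (forall x, x + x \in N) ->
  has_bits N u v c x s -> has_bits N u v c y t ->
  has_bits N u v c (x + y) (xor3 s t).
Proof.
move=> hN N2 xs yt; rewrite /has_bits /xor3 /bitsum /=.
have key (z : L) (a b : bool) : z *+ a + z *+ b - z *+ (a (+) b) \in N.
  by case: a b => [] []; rewrite /= ?mulr0n ?mulr1n ?subr0 ?addr0 ?add0r ?subrr ?N2 ?hN.1.
have := zmod_closed_add_in hN (zmod_closed_add_in hN xs yt)
  (zmod_closed_add_in hN (zmod_closed_add_in hN (key u s.1.1 t.1.1) (key v s.1.2 t.1.2))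
     (key c s.2 t.2)).
rewrite /bitsum; congr (_ \in N); zmod.
Qed.

Lemma has_bitsN (L : finZmodType) (N : {set L}) (u v c x : L) t :
  zmod_closed N -> (forall x, x + x \in N) ->
  has_bits N u v c x t -> has_bits N u v c (- x) t.
Proof.
move=> hN N2 xt; rewrite /has_bits.
have -> : - x - bitsum u v c t = (x - bitsum u v c t) - (x + x) by zmod.
exact: hN.2.
Qed.

Lemma has_bits_notin (L : finZmodType) (N : {set L}) (u v c x : L) t :
  zmod_closed N -> (forall x, x + x \in N) ->
  u \notin N -> v \notin adjoin N u -> c \notin adjoin (adjoin N u) v ->
  has_bits N u v c x t -> t != (false, false, false) -> x \notin N.
Proof.
move=> hN N2 uN vN cN xt t0.
suff bN : bitsum u v c t \notin N.
  apply: contra bN => xN; rewrite -[bitsum _ _ _ _](subKr x).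
  exact: hN.2.
have minus z w : z + w \in N -> z - w \in N.
  by move=> h; have -> : z - w = z + w - (w + w); [zmod|apply: hN.2].
move: vN cN; rewrite !inE !negb_or => /andP[vN vuN] /andP[/andP[cN cuN] /andP[cvN cvuN]].
case: t t0 {xt} => [[[] []] []] //= _; rewrite /bitsum /= ?mulr0n ?mulr1n ?addr0 ?add0r //.
- apply: contra cvuN => h; have -> : c - v - u = u + v + c - (u + u) - (v + v) by zmod.
  by rewrite !hN.2.
- by apply: contra vuN => h; apply: minus; rewrite addrC.
- by apply: contra cuN => h; apply: minus; rewrite addrC.
- by apply: contra cvN => h; apply: minus; rewrite addrC.
Qed.

(** Descends through an expression and assembles its bits, first unknown, from those of its
    atoms. *)
Ltac bits be b0 bv bc D B :=
  match goal with
  | |- is_true (has_bits _ _ _ _ (_ + _) _) => eapply D; bits be b0 bv bc D B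
  | |- is_true (has_bits _ _ _ _ (- _) _) => eapply B; bits be b0 bv bc D B
  | |- is_true (has_bits _ _ _ _ 0 _) => exact b0
  | |- _ => first [exact bv | exact bc | exact (be _)]
  end.

(* The only base case in which the three colours differ. They have to: in (Z/2)^3
   the elements and sums of two pairs would be two disjoint lines of the Fano plane. *)
Lemma config_order8_elementary (L : finZmodType) (N : {set L}) u v c :
  zmod_closed N -> (forall x, x + x \in N) -> (#|L| <= 8 * #|N|)%N ->
  u \notin N -> v \notin adjoin N u -> c \notin adjoin (adjoin N u) v ->
  exists D, config N D.
Proof.
move=> hN N2 cN uN vN cvN.
(* Colour [i] gets the pairs [(0, E i)] and [(v, c)]. The three values of [E] are distinct modulo
   [N] and outside the span of [v] and [c], so the sum [E i] avoids the members of the other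
   colours. *)
pose E (i : 'I_3) := nth 0 [:: u; u + v; u + c] i.
pose bE (i : 'I_3) := (true, i == 1%N :> nat, i == 2%N :> nat).
have b0 : has_bits N u v c 0 (false, false, false).
  by rewrite /has_bits /bitsum !mulr0n !addr0 subrr hN.1.
have bv : has_bits N u v c v (false, true, false).
  by rewrite /has_bits /bitsum !mulr0n mulr1n addr0 add0r subrr hN.1.
have bc : has_bits N u v c c (false, false, true).
  by rewrite /has_bits /bitsum !mulr0n mulr1n !add0r subrr hN.1.
have be i : has_bits N u v c (E i) (bE i).
  rewrite /has_bits /bitsum; case: i => [[|[|[|//]]] ?];
    by rewrite /= ?mulr0n !mulr1n ?addr0 subrr hN.1.
clearbody E.
have notin x t : has_bits N u v c x t -> t != (false, false, false) -> x \notin N.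
  exact: has_bits_notin.
have D x y s t : has_bits N u v c x s -> has_bits N u v c y t ->
  has_bits N u v c (x + y) (xor3 s t) by apply: has_bitsD.
have B x t : has_bits N u v c x t -> has_bits N u v c (- x) t by apply: has_bitsN.
exists (fun i => [:: (0, E i); (v, c)]); split => //=.
- move=> i; rewrite inE andbT; apply: contraNneq vN => [[<- _]].
  by rewrite inE hN.1.
- have solve x t : has_bits N u v c x t -> t != (false, false, false) -> forall P : Prop, x \in N -> P.
    by move=> xt t0 P xN; case/negP: (notin _ _ xt t0).
  move=> i p q; rewrite !mem_seq2 => /orP[] /eqP -> /orP[] /eqP -> /=; split=> //;
    try (apply: notin; [bits be b0 bv bc D B|]);
    try (apply: solve; [bits be b0 bv bc D B|]);
    by case: i => [[|[|[|//]]] ?].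
- move=> i j ij p q; rewrite !mem_seq2 => /orP[] /eqP -> /orP[] /eqP -> /=; split=> //;
    (apply: notin; [bits be b0 bv bc D B|]);
    by case: i j ij => [[|[|[|//]]] ?] [[|[|[|//]]] ?].
Qed.

(** * Lifting configurations along a Klein group; existence *)

Definition klein (L : zmodType) (u v : L) (k : bool * bool) : L := u *+ k.1 + v *+ k.2.

(* Writing the Klein group as the additive group of F_4, these are multiplication
   by w and by w^2 = 1 + w. *)
Definition klein_rot (k : bool * bool) : bool * bool := (k.2, k.1 (+) k.2).

Definition klein_rot2 (k : bool * bool) : bool * bool := (k.1 (+) k.2, k.1).

Definition klein_index : seq (bool * bool) :=
  [:: (false, false); (false, true); (true, false); (true, true)].

(** In the notation of F_4, the first members, second members and sums are shifted by [k], [wk] and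
    [(1 + w)k]. Each of these runs through the whole Klein group, so all three kinds stay
    distinct. *)
Definition lift_pairs (L : zmodType) (u v : L) (D : seq (L * L)) : seq (L * L) :=
  [seq (p.1 + klein u v k, p.2 + klein u v (klein_rot k)) | p <- D, k <- klein_index].

Lemma klein_in (L : finZmodType) (N : {set L}) u v k :
  zmod_closed N -> u \in N -> v \in N -> klein u v k \in N.
Proof.
move=> hN uN vN; rewrite /klein; case: k => [[] []] /=;
  rewrite ?mulr0n ?mulr1n ?addr0 ?add0r ?hN.1 //.
exact: zmod_closed_add_in.
Qed.

Lemma klein_inj (L : finZmodType) (N : {set L}) u v k k' :
  zmod_closed N -> u \notin N -> u + u \in N -> v \notin adjoin N u -> v + v \in N ->
  klein u v k - klein u v k' \in N -> k = k'.
Proof.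
move=> hN uN u2; rewrite inE negb_or => /andP[vN vuN] v2 h.
have key (z : L) (a b : bool) : z + z \in N -> z *+ a - z *+ b - z *+ (a (+) b) \in N.
  by move=> z2; case: a b => [] []; rewrite /= ?mulr0n ?mulr1n ?subr0 ?addr0 ?sub0r ?subrr
    ?hN.1 // -opprD zmod_closed_opp_in.
have {}h : klein u v (k.1 (+) k'.1, k.2 (+) k'.2) \in N.
  have := hN.2 _ _ h (zmod_closed_add_in hN (key u k.1 k'.1 u2) (key v k.2 k'.2 v2)).
  by rewrite /klein; congr (_ \in N); zmod.
case: k k' h => [a b] [a' b'] /=; rewrite /klein /=.
case: a a' b b' => [] [] [] [] //=; rewrite ?mulr0n ?mulr1n ?addr0 ?add0r ?(negbTE uN) ?(negbTE vN) //.
all: move=> h; case/negP: vuN; have -> : v - u = u + v - (u + u) by zmod.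
all: exact: hN.2.
Qed.

Lemma klein_rotD (L : finZmodType) (N : {set L}) u v k :
  zmod_closed N -> u + u \in N -> v + v \in N ->
  klein u v k + klein u v (klein_rot k) - klein u v (klein_rot2 k) \in N.
Proof.
move=> hN u2 v2; rewrite /klein; case: k => [[] []] /=;
  rewrite !(mulr0n, mulr1n, subr0, addr0, add0r, subrr) ?hN.1 //.
  by have -> : u + v + u - v = u + u by zmod.
by have -> : v + (u + v) - u = v + v by zmod.
Qed.

(** Reduction modulo the larger subgroup returns the pairs of [D]. This settles different pairs and
    different colours; lifts of the same pair are told apart by their Klein parts. *)
Lemma config_lift (L : finZmodType) (N : {set L}) u v D :
  zmod_closed N -> u \notin N -> u + u \in N -> v \notin adjoin N u -> v + v \in N ->
  config (adjoin (adjoin N u) v) D ->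
  config N (fun i => lift_pairs u v (D i)).
Proof.
move=> hN uN u2 vN v2; set N' := adjoin _ v.
have hNu : zmod_closed (adjoin N u) by apply: adjoin_zmod_closed.
have hN' : zmod_closed N' by apply: adjoin_zmod_closed => //; apply: sub_adjoin.
have cN' : #|N'| = (4 * #|N|)%N by rewrite !card_adjoin //; ring.
have NN' : {subset N <= N'} by move=> x xN; do 2!apply: sub_adjoin.
have kN' k : klein u v k \in N'.
  by apply: klein_in => //; [apply/sub_adjoin/adjoin_gen|apply: adjoin_gen].
have kinj k k' : klein u v k - klein u v k' \in N -> k = k' by apply: klein_inj.
have kD k := klein_rotD k hN u2 v2.
clearbody N'.
have drop x k k' : x + (klein u v k - klein u v k') \in N -> x \in N'.
  move=> /NN' h; rewrite -[x](addrK (klein u v k - klein u v k')).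
  by rewrite hN'.2 // hN'.2.
have rot_inj k k' : klein_rot k = klein_rot k' -> k = k' by case: k k' => [[] []] [[] []].
have rot2_inj k k' : klein_rot2 k = klein_rot2 k' -> k = k' by case: k k' => [[] []] [[] []].
have memP (s : seq (L * L)) (p : L * L) : p \in lift_pairs u v s -> exists q k,
    q \in s /\ p = (q.1 + klein u v k, q.2 + klein u v (klein_rot k)).
  by move=> /allpairsP[[q k] [/= qs _ ->]]; exists q, k.
move=> [cD uD inD exD]; split.
- move=> i; rewrite size_allpairs /=; apply: leq_trans (cD i) _; rewrite cN'; apply: eq_leq; ring.
- move=> i; apply: allpairs_uniq => //.
  move=> [p k] [q l] /allpairsP[[p' k'] [pD _ [-> ->]]] /allpairsP[[q' l'] [qD _ [-> ->]]].
  move=> [e1 e2] /=; rewrite /= in pD qD e1 e2; have [d1 _ _ _] := inD i p' q' pD qD.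
  have h : p'.1 - q'.1 + (klein u v k' - klein u v l') \in N.
    have -> : p'.1 - q'.1 + (klein u v k' - klein u v l') = p'.1 + klein u v k' - (q'.1 + klein u v l') by zmod.
    by rewrite e1 subrr hN.1.
  have e := d1 (drop _ _ _ h); move: h; rewrite e subrr add0r => /kinj ->.
  by [].
- move=> i _ _ /memP[p [k [pD ->]]] /memP[q [l [qD ->]]] /=.
  have [d1 d2 d3 d4] := inD i p q pD qD; split.
  + have -> : p.1 + klein u v k - (q.1 + klein u v l) = p.1 - q.1 + (klein u v k - klein u v l) by zmod.
    by move=> h; move: (h); rewrite (d1 (drop _ _ _ h)) subrr add0r => /kinj ->.
  + have -> : p.2 + klein u v (klein_rot k) - (q.2 + klein u v (klein_rot l)) =
      p.2 - q.2 + (klein u v (klein_rot k) - klein u v (klein_rot l)) by zmod.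
    by move=> h; move: (h); rewrite (d2 (drop _ _ _ h)) subrr add0r => /kinj/rot_inj ->.
  + move=> h.
    have {}h : p.1 + p.2 - (q.1 + q.2) + (klein u v (klein_rot2 k) - klein u v (klein_rot2 l)) \in N.
      have := zmod_closed_add_in hN (hN.2 _ _ h (kD k)) (kD l).
      by congr (_ \in N); zmod.
    by move: (h); rewrite (d3 (drop _ _ _ h)) subrr add0r => /kinj/rot2_inj ->.
  + apply: contra d4 => h; apply: (drop _ k (klein_rot l)).
    by move: h; congr (_ \in N); zmod.
- move=> i j ij _ _ /memP[p [k [pD ->]]] /memP[q [l [qD ->]]] /=.
  have [d1 d2 d3 d4] := exD i j ij p q pD qD.
  have red x y : x \in N -> y \in N' -> x - y \in N' by move=> /NN' xN yN; apply: hN'.2.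
  have kkN' := zmod_closed_add_in hN' (kN' k) (kN' (klein_rot k)).
  have sub l' := hN'.2 _ _ kkN' (kN' l').
  have add l' := zmod_closed_add_in hN' kkN' (kN' l').
  split; [apply: contra d1 => h; have := red _ _ h (sub l)
    | apply: contra d2 => h; have := red _ _ h (add l)
    | apply: contra d3 => h; have := red _ _ h (sub (klein_rot l))
    | apply: contra d4 => h; have := red _ _ h (add (klein_rot l))];
    by congr (_ \in N'); zmod.
Qed.

Lemma double_adjoin (L : finZmodType) (N M : {set L}) u z :
  zmod_closed N -> u + u \in N -> (forall y, y \in M -> y + y \in N) ->
  z \in adjoin M u -> z + z \in N.
Proof.
move=> hN u2 hM; rewrite inE => /orP[/hM//|/hM h].
have -> : z + z = z - u + (z - u) + (u + u) by zmod.
exact: zmod_closed_add_in.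
Qed.

(** Induction on the index of [N]. With a single involution modulo [N] there is a direct
    construction. Otherwise a Klein group is adjoined to [N] and the configuration lifted back, as
    long as the index is at least 16; indices 4 and 8 are the base cases. *)
Lemma config_exists (L : finZmodType) eta (N : {set L}) :
  #|L| = (2 ^ eta)%N -> zmod_closed N -> (4 * #|N| <= #|L|)%N ->
  exists D, config N D.
Proof.
move=> cL; elim/ltn_ind: {N}(#|L| - #|N|)%N {-2}N (erefl (#|L| - #|N|)%N) => n IH N en hN cN.
have N0 : (0 < #|N|)%N by apply/card_gt0P; exists 0; case: hN.
have [|x xN] := @exists_notin L N; first by lia.
have [j uN u2] := double_into cL hN xN; set u := x *+ 2 ^ j in uN u2.
have [/existsP[v /andP[v2 vN]]|] := boolP [exists v, (v + v \in N) && (v \notin adjoin N u)];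
  last first.
  rewrite negb_exists => /forallP h; apply: (config_unique_involution (u := u)) cL hN cN uN u2 _.
  by move=> y y2; have := h y; rewrite y2 negbK.
have hNu : zmod_closed (adjoin N u) by apply: adjoin_zmod_closed.
have hN' : zmod_closed (adjoin (adjoin N u) v).
  by apply: adjoin_zmod_closed => //; apply: sub_adjoin.
have cN' : #|adjoin (adjoin N u) v| = (4 * #|N|)%N by rewrite !card_adjoin //; ring.
have [k ek] : exists k, #|L| = (2 ^ k * #|N|)%N.
  have := card_zmod_dvdn hN; rewrite cL => /[dup] /(dvdn_pfactor _ _ (isT : prime 2)) [m lem ->].
  by move=> _; exists (eta - m)%N; rewrite -expnD subnK.
have [k4|[k8|k16]] : (#|L| <= 4 * #|N| \/ #|L| = 8 * #|N| \/ 16 * #|N| <= #|L|)%N.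
- case: k ek => [|[|[|[|k]]]] ->; [left; lia|left; lia|left; lia|right; left; lia|].
  by right; right; rewrite leq_mul2r (leq_pexp2l (m := 2) (n1 := 4)) ?orbT.
- exact: config_klein hN k4 u2 v2 uN vN.
- have [/existsP[y y2]|] := boolP [exists y, y + y \notin N].
    apply: (config_order8_cyclic4 hN k8 y2).
    (* [y] has order dividing 4 modulo [N]: its double lies in the subgroup of index 2, all of whose
       elements have their double in [N]. *)
    have y2N' := double_index2 hN' (_ : (#|L| <= 2 * #|adjoin (adjoin N u) v|)%N) y.
    apply: (double_adjoin hN v2 (z := y + y)); [|apply: y2N'; lia] => z.
    by apply: (double_adjoin hN u2) => *; apply: zmod_closed_add_in.
  rewrite negb_exists => /forallP h.
  have [|c cN2] := @exists_notin L (adjoin (adjoin N u) v); first by lia.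
  apply: (config_order8_elementary hN _ _ uN vN cN2); last by rewrite k8.
  by move=> y; have := h y; rewrite negbK.
- have [||D cD] := IH (#|L| - #|adjoin (adjoin N u) v|)%N _ (adjoin (adjoin N u) v) erefl hN'.
  + by lia.
  + by lia.
  exists (fun i => lift_pairs u v (D i)); exact: config_lift.
Qed.

(** * A 3-colouring compatible with doubling *)

Lemma mulrn_eq0_coprime (H : finZmodType) (k : nat) (z : H) :
  coprime k #|H| -> z *+ k = 0 -> z = 0.
Proof.
have H0 : (0 < #|H|)%N by apply/card_gt0P; exists 0.
case: k => [|k]; first by rewrite /coprime gcd0n => /eqP cH _; have := mulrn_card z; rewrite cH.
move=> /eqP co zk; have [a b e _] := egcdnP #|H| (ltn0Sn k).
have l : z *+ (a * k.+1) = 0 by rewrite mulnC mulrnA zk mul0rn.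
have r : z *+ (b * #|H| + 1) = z.
  by rewrite mulrnDr mulnC mulrnA mulrn_card mul0rn add0r.
by rewrite -r -co -e.
Qed.

(** Up to sign, [x] has only the neighbours [2x] and its half, so greedy colouring always finds a
    third colour free. A nonzero [x] is not its own neighbour, since neither [x] nor [3x] is 0. *)
Lemma double_colouring (H : finZmodType) :
  coprime 2 #|H| -> coprime 3 #|H| ->
  exists col : H -> 'I_3,
    (forall x : H, col (- x) = col x) /\ (forall x : H, x != 0 -> col (x + x) != col x).
Proof.
move=> co2 co3.
have d_inj : injective (fun x : H => x + x).
  move=> x y /eqP; rewrite -subr_eq0 => /eqP e; apply/eqP; rewrite -subr_eq0; apply/eqP.
  apply: (mulrn_eq0_coprime co2); rewrite -[RHS]e; zmod.
have no3 (x : H) : x != 0 -> x + x <> - x.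
  move=> x0 e; case/eqP: x0; apply: (mulrn_eq0_coprime co3).
  by rewrite mulrS mulr2n e subrr.
have no1 (x : H) : x != 0 -> x + x <> x.
  by move=> x0 e; case/eqP: x0; apply: (addrI x); rewrite e addr0.
have third (a b : 'I_3) : exists c : 'I_3, c != a /\ c != b.
  by case: a b => [[|[|[|//]]] ?] [[|[|[|//]]] ?];
    (by exists 0) || (by exists 1) || (by exists (1 + 1)).
(* The induction runs over the list of elements coloured so far; the condition is only asked for
   elements listed up to sign. *)
suff [col [sym ok]] : exists col : H -> 'I_3, (forall x : H, col (- x) = col x) /\
    forall x : H, x != 0 -> (x \in enum H) || (- x \in enum H) ->
      (x + x \in enum H) || (- (x + x) \in enum H) -> col (x + x) != col x.
  by exists col; split=> // x x0; apply: ok; rewrite ?mem_enum.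
elim: (enum H) => [|z s [col [sym ok]]]; first by exists (fun _ => 0).
pose half := invF d_inj z.
have hz : half + half = z by apply: (f_invF d_inj).
clearbody half.
have [c [c1 c2]] := third (col (z + z)) (col half).
pose in_s (x : H) := (x \in s) || (- x \in s).
pose is_z (x : H) := (x == z) || (x == - z).
have is_zN (x : H) : is_z (- x) = is_z x by rewrite /is_z eqr_opp eqr_oppLR orbC.
exists (fun x => if is_z x then c else col x); split=> [x|x x0].
  by rewrite is_zN sym.
have notz (y : H) : y != 0 -> is_z y -> is_z (y + y) = false.
  move=> y0 zy; apply/negbTE/negP => zyy.
  have [] : y + y = y \/ y + y = - y; [|exact: no1|exact: no3].
  move: zy zyy; rewrite /is_z => /orP[] /eqP -> /orP[] /eqP ->;
    rewrite ?opprK; by [left|right].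
case: ifP => zxx; case: ifP => zx; first by rewrite notz in zxx.
- suff -> : col x = col half by [].
  case/orP: zxx => /eqP e; first by congr col; apply: d_inj; rewrite e hz.
  by rewrite -(sym half); congr col; apply: d_inj; rewrite e -opprD hz.
- suff <- : col (z + z) = col (x + x) by rewrite eq_sym.
  by case/orP: zx => /eqP ->; rewrite // -opprD sym.
- have in_sP (y : H) : is_z y = false -> (y \in z :: s) || (- y \in z :: s) -> in_s y.
    rewrite /is_z /in_s !inE eqr_oppLR => /norP[/negbTE -> /negbTE ->].
    by rewrite !orFb.
  by move=> /(in_sP _ zx) h /(in_sP _ zxx) h'; apply: ok.
Qed.

(** * The 2-torsion, and pairs whose sums differ by an involution *)

Lemma zmod_closed0 (L : finZmodType) : zmod_closed [set (0 : L)].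
Proof. by split=> [|x y]; rewrite !inE // => /eqP -> /eqP ->; rewrite subr0. Qed.

Definition torsion2 (L : finZmodType) : {set L} := [set x | x + x == 0].

Lemma torsion2_zmod_closed (L : finZmodType) : zmod_closed (torsion2 L).
Proof.
split=> [|x y]; rewrite !inE ?addr0 // => /eqP x2 /eqP y2.
have -> : x - y + (x - y) = (x + x) - (y + y) by zmod.
by rewrite x2 y2 subr0.
Qed.

Lemma card_torsion2 (L : finZmodType) : #|torsion2 L| = #|involutions L|.+1.
Proof.
have -> : involutions L = torsion2 L :\ 0 by apply/setP => x; rewrite !inE.
by rewrite (cardsD1 0 (torsion2 L)) inE addr0 eqxx.
Qed.

Definition twin_sum (L : zmodType) (u : L) (e : (L * L) * (L * L)) : Prop :=
  e.2.1 + e.2.2 = e.1.1 + e.1.2 + u.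

(** In the order of [klein_index] the sums of the four lifts are shifted by 0, [u], [u + v], [v]:
    consecutive lifts are twins. *)
Lemma lift_pairs_twins (L : zmodType) (u v : L) (D : seq (L * L)) : u + u = 0 -> v + v = 0 ->
  exists E, [/\ lift_pairs u v D = flatten [seq [:: e.1; e.2] | e <- E],
    {in E, forall e, twin_sum u e} & size E = (2 * size D)%N].
Proof.
move=> u2 v2; pose g (p : L * L) k := (p.1 + klein u v k, p.2 + klein u v (klein_rot k)).
elim: D => [|p D [E [eE tE sE]]]; first by exists [::].
exists [:: (g p (false, false), g p (false, true)),
  (g p (true, false), g p (true, true)) & E]; split.
- by rewrite /= -eE.
- move=> e; rewrite !inE => /or3P[/eqP ->|/eqP ->|/tE //]; rewrite /twin_sum /g /klein /=;
    rewrite !(mulr0n, mulr1n, addr0, add0r).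
    transitivity (p.1 + p.2 + u + (v + v)); first zmod.
    by rewrite v2 addr0.
  transitivity (p.1 + p.2 + v + (u + u)); first zmod.
  zmod.
- by rewrite /= sE; lia.
Qed.

(** For [#|L|] at least 16 the configuration is taken as a lift, which consists of twins. Otherwise,
    if the 2-torsion has 8 elements, it is all of [L], and any two pairs of one colour are twins for
    the difference of their sums; this is why [u] may depend on the colour. *)
Lemma config_twins (L : finZmodType) eta : #|L| = (2 ^ eta)%N -> (4 <= #|torsion2 L|)%N ->
  exists D, config [set (0 : L)] D /\ forall i, exists (u : L) (E : seq ((L * L) * (L * L))) (rest : seq (L * L)),
    [/\ u != 0, u + u = 0,
        perm_eq (D i) (flatten [seq [:: e.1; e.2] | e <- E] ++ rest),
        {in E, forall e, twin_sum u e} &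
        (8 <= #|torsion2 L|)%N -> (#|L| <= 8 * size E)%N].
Proof.
move=> cL V4; have h0 := zmod_closed0 L.
have VL : (#|torsion2 L| <= #|L|)%N by apply: max_card.
have V_ex (A : {set L}) : (#|A| < 4)%N -> exists2 v, v + v = 0 & v \notin A.
  move=> cA; have /subsetPn[v] : ~~ (torsion2 L \subset A).
    by apply/negP => /subset_leq_card; lia.
  by rewrite inE => /eqP; exists v.
have [|u u2] := V_ex [set 0]; first by rewrite cards1.
rewrite inE => u0.
have uN : u \notin [set (0 : L)] by rewrite inE.
have cA : #|adjoin [set 0] u| = 2 by rewrite card_adjoin // cards1.
have [|v v2 vN] := V_ex (adjoin [set 0] u); first by rewrite cA.
have hA : zmod_closed (adjoin [set 0] u) by apply: adjoin_zmod_closed; rewrite ?u2 ?inE.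
have [V8|V8] := ltnP #|torsion2 L| 8.
  have [|D cD] := config_exists cL h0; first by rewrite cards1; lia.
  exists D; split=> // i; exists u, [::], (D i); split=> //.
have [L16|L16] := leqP 16 #|L|.
  pose K := adjoin (adjoin [set 0] u) v.
  have cK : #|K| = 4 by rewrite card_adjoin // cA.
  have hK : zmod_closed K by apply: adjoin_zmod_closed; rewrite // v2; case: hA.
  have [|D cD] := config_exists cL hK; first by rewrite cK.
  exists (fun i => lift_pairs u v (D i)); split.
    by apply: config_lift => //; rewrite ?u2 ?v2 inE.
  move=> i; have [E [eE tE sE]] := lift_pairs_twins (D i) u2 v2.
  exists u, E, [::]; split=> //; first by rewrite cats0 eE.
  by move=> _; have [h _ _ _] := cD; apply: leq_trans (h i) _; rewrite cK sE; apply: eq_leq; ring.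
have L8 : #|L| = 8.
  move: L16 (leq_trans V8 VL); rewrite cL; case: eta {cL} => [|[|[|[|eta]]]] //.
  by move=> h; have := leq_trans h (leq_pexp2l (isT : 0 < 2)%N (isT : (4 <= eta.+4)%N)); rewrite ltnn.
have allV (x : L) : x + x = 0.
  have /eqP e : torsion2 L == setT.
    rewrite eqEcard subsetT cardsT /=; apply: leq_trans V8; exact: eq_leq L8.
  by apply/eqP; have := in_setT x; rewrite -e inE.
have [|D cD] := config_exists cL h0; first by rewrite cards1; lia.
exists D; split=> // i; have [+ uD inD _] := cD => /(_ i).
have := inD i; have := uD i; rewrite cards1 L8; case: (D i) => [|p [|q r]] //= unq inj _.
exists (q.1 + q.2 - (p.1 + p.2)), [:: (p, q)], r; split=> //.
- move: unq; rewrite inE negb_or => /andP[/andP[pq _] _].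
  have [_ _ h _] := inj q p (mem_behead (s := [:: p, q & r]) (mem_head _ _)) (mem_head _ _).
  by apply: contra pq => e; rewrite eq_sym; apply/eqP/h; rewrite inE.
- by move=> e; rewrite inE => /eqP ->; rewrite /twin_sum /=; zmod.
Qed.

Lemma config_eq (L : finZmodType) (D : 'I_3 -> seq (L * L)) : config [set (0 : L)] D ->
  [/\ forall i, {in D i &, forall p q : L * L,
        [/\ p.1 = q.1 -> p = q, p.2 = q.2 -> p = q, p.1 + p.2 = q.1 + q.2 -> p = q
          & p.1 <> q.2]} &
      forall i j, i != j -> forall p q, p \in D i -> q \in D j ->
        forall b : bool, forall a, a = q.1 \/ a = q.2 -> p.1 + p.2 <> (if b then - a else a)].
Proof.
have eqm (x y : L) : (x - y \in [set 0]) = (x == y) by rewrite inE subr_eq0.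
move=> [_ _ inD exD]; split.
  move=> i p q pD qD; have [] := inD i p q pD qD.
  rewrite !eqm => h1 h2 h3 /eqP h4.
  by split=> // /eqP; [apply: h1|apply: h2|apply: h3].
move=> i j ij p q pD qD b a ha; have [] := exD i j ij p q pD qD.
rewrite -[q.1 in X in _ -> X -> _]opprK -[q.2 in X in _ -> _ -> _ -> X -> _]opprK !eqm.
by move=> /eqP h1 /eqP h2 /eqP h3 /eqP h4; case: ha b => -> [].
Qed.

(** * Disjoint six-sets *)

Definition six (G : zmodType) (t : G * G * G) : seq G :=
  [:: t.1.1; t.1.2; t.2; - t.1.1; - t.1.2; - t.2].

Definition fibre_triple (L H : zmodType) (p : L * L) (x : H) :
    (L * H) * (L * H) * (L * H) :=
  ((p.1, x), (p.2, x), (- (p.1 + p.2), - (x + x))).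

Definition oppb (G : zmodType) (b : bool) (x : G) : G := if b then - x else x.

Lemma mem_six_fibre (L H : zmodType) (p : L * L) (x : H) (g : L * H) :
  g \in six (fibre_triple p x) -> exists b,
    (exists2 a, a = p.1 \/ a = p.2 & g.1 = oppb b a /\ g.2 = oppb b x) \/
    (g.1 = oppb b (p.1 + p.2) /\ g.2 = oppb b (x + x)).
Proof.
rewrite !inE /=; case/or4P => [/eqP->|/eqP->|/eqP->|/or3P[/eqP->|/eqP->|/eqP->]] /=.
- by exists false; left; exists p.1; [left|].
- by exists false; left; exists p.2; [right|].
- by exists true; right.
- by exists true; left; exists p.1; [left|].
- by exists true; left; exists p.2; [right|].
- by exists false; right; rewrite /= !opprK.
Qed.

(** The second coordinates are [x] or [2x] up to sign, and [X] has one element of each opposite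
    pair. Two coordinates of the same type force the same [x], where the pairs of one colour are
    separated; mixed types are separated by the colouring. *)
Lemma uniq_sixes (L H : finZmodType) (D : 'I_3 -> seq (L * L)) (col : H -> 'I_3) (X : seq H) :
  config [set (0 : L)] D -> coprime 2 #|H| -> coprime 3 #|H| ->
  (forall x : H, col (- x) = col x) -> (forall x : H, x != 0 -> col (x + x) != col x) ->
  uniq X -> {in X &, forall x y : H, x <> - y} ->
  uniq (flatten (map (@six (L * H)%type) [seq fibre_triple p x | x <- X, p <- D (col x)])).
Proof.
move=> cD co2 co3 sym ok uX NX; have [inD exD] := config_eq cD; have [_ uD _ _] := cD.
have d0 (x : H) : x + x = 0 -> x = 0 by move=> e; apply: (mulrn_eq0_coprime co2).
have d_inj (x y : H) : x + x = y + y -> x = y.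
  move=> e; apply/eqP; rewrite -subr_eq0; apply/eqP/d0.
  have -> : x - y + (x - y) = x + x - (y + y) by zmod.
  by rewrite e subrr.
have X0 (x : H) : x \in X -> x != 0.
  by move=> xX; apply/eqP => e; apply: (NX x x xX xX); rewrite e oppr0.
have sgX (x y : H) b b' : x \in X -> y \in X -> oppb b x = oppb b' y -> b = b' /\ x = y.
  move=> xX yX; case: b b' => [] [] /=.
  - by move/oppr_inj.
  - by move=> e; case: (NX y x yX xX); rewrite e.
  - by move=> e; case: (NX x y xX yX).
  - by [].
have sgX2 (x y : H) b b' : x \in X -> y \in X -> oppb b (x + x) = oppb b' (y + y) ->
    b = b' /\ x = y.
  move=> xX yX e; apply: sgX => //; apply: d_inj.
  by move: e; case: b b' => [] [] /=; rewrite -?opprD.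
have sg_inj (G : zmodType) b (x y : G) : oppb b x = oppb b y -> x = y.
  by case: b => //= /oppr_inj.
have low (x y : H) p q b b' a a' : x \in X -> y \in X -> p \in D (col x) -> q \in D (col y) ->
    (a = p.1 \/ a = p.2) -> (a' = q.1 \/ a' = q.2) -> oppb b a = oppb b' a' ->
    oppb b x = oppb b' y -> p = q /\ x = y.
  move=> xX yX pD qD ha ha' e1 /(sgX _ _ _ _ xX yX)[eb exy]; split=> //.
  subst y b'; move/sg_inj: e1 => e1; have [h1 h2 _ h4] := inD _ p q pD qD.
  have [_ _ _ h5] := inD _ q p qD pD.
  case: ha ha' => [ea|ea] [ea'|ea']; subst a; subst a'; by [apply: h1|apply: h2|case: h4|case: h5].
(* If [x] is [2y] up to sign, then [x] and [y] have different colours, so a sum at [y] is never a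
   member at [x], even up to sign. *)
have mixed (x y : H) p q b b' a : x \in X -> y \in X -> p \in D (col x) -> q \in D (col y) ->
    (a = p.1 \/ a = p.2) -> oppb b a = oppb b' (q.1 + q.2) -> oppb b x <> oppb b' (y + y).
  move=> xX yX pD qD ha e1 e2.
  have cxy : col y != col x.
    have := ok y (X0 y yX); rewrite eq_sym; suff -> : col (y + y) = col x by [].
    have cb (z : H) c : col (oppb c z) = col z by case: c => /=.
    by rewrite -(cb _ b') -e2 cb.
  apply: (exD _ _ cxy q p qD pD (b (+) b') a ha).
  case: b b' {e2} e1 => [] [] /= e1.
  - exact/esym/oppr_inj.
  - by rewrite e1.
  - by rewrite e1 opprK.
  - by rewrite e1.
have T_inj (x y : H) (p q : L * L) : fibre_triple p x = fibre_triple q y -> p = q /\ x = y.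
  by case: p q => [a b] [c d] [-> -> -> _ _].
apply: uniq_flatten_map.
- apply: allpairs_uniq_dep => //.
  by move=> [x p] [y q] _ _ /= /T_inj[-> ->].
- move=> _ /allpairsPdep[x [p [xX pD ->]]].
  have xN : x <> - x by apply: NX.
  have x0 := X0 x xX; have x20 : x + x <> 0 by move/d0/eqP; apply/negP.
  have x2N : - (x + x) <> x + x by move=> e; apply: x20; apply: d0; rewrite -{1}e addNr.
  have x3 : x + x <> - x.
    move=> e; case/eqP: x0; apply: (mulrn_eq0_coprime co3).
    by rewrite mulrS mulr2n e subrr.
  have x1 : x + x <> x by move=> e; case/eqP: x0; apply: (addrI x); rewrite e addr0.
  have [_ _ _ p12] := inD _ p p pD pD.
  rewrite /six /fibre_triple /= !inE !negb_or !xpair_eqE.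
  have x4 : x <> - (x + x) by move=> e; apply: x3; rewrite [in RHS]e opprK.
  have x5 : - x <> x + x by move=> e; apply: x3.
  move: xN x1 x2N x3 x4 x5 p12.
  do 7![move=> /eqP/negbTE ?].
  have e1 : (x == x + x) = false by rewrite eq_sym.
  have e2 : (- (x + x) == - x) = false by rewrite eqr_opp.
  have e3 : (- p.1 == - p.2) = false by rewrite eqr_opp.
  by repeat (rewrite /= ?opprK; match goal with H : _ = false |- _ => rewrite H end);
    rewrite ?andbF.
- move=> _ _ /allpairsPdep[x [p [xX pD ->]]] /allpairsPdep[y [q [yX qD ->]]] g.
  move=> /mem_six_fibre[b hb] /mem_six_fibre[b' hb'].
  suff [-> ->] : p = q /\ x = y by [].
  case: hb hb' => [[a ha [e1 e2]]|[e1 e2]] [[a' ha' [e1' e2']]|[e1' e2']];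
    rewrite e1 in e1'; rewrite e2 in e2'.
  + exact: low e1' e2'.
  + by case: (mixed x y p q b b' a xX yX pD qD ha e1').
  + by case: (mixed y x q p b' b a' yX xX qD pD ha' (esym e1')).
  + have [eb exy] := sgX2 _ _ _ _ xX yX e2'; subst y b'; split=> //.
    by have [_ _ h _] := inD _ p q pD qD; apply/h/(sg_inj _ b).
Qed.

(* When a1 + b1 and a2 + b2 differ by an involution u, exchanging the third
   components of two zero-sum triples gives two triples of sum (u, 0) with the same
   elements. *)
Definition swapped_triples (L H : zmodType) (x : H) (e : (L * L) * (L * L)) :
    seq ((L * H) * (L * H) * (L * H)) :=
  [:: ((e.1.1, x), (e.1.2, x), (- (e.2.1 + e.2.2), - (x + x)));
      ((e.2.1, x), (e.2.2, x), (- (e.1.1 + e.1.2), - (x + x)))].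

Definition triple_sum (G : zmodType) (t : G * G * G) : G := t.1.1 + t.1.2 + t.2.

Definition sixes (G : zmodType) (T : seq (G * G * G)) : seq G := flatten (map (@six G) T).

Lemma sixes_cat (G : zmodType) (S T : seq (G * G * G)) : sixes (S ++ T) = sixes S ++ sixes T.
Proof. by rewrite /sixes map_cat flatten_cat. Qed.

Lemma size_sixes (G : zmodType) (T : seq (G * G * G)) : size (sixes T) = (6 * size T)%N.
Proof. by rewrite /sixes; elim: T => //= t T ->; lia. Qed.

Lemma perm_sixes (G : zmodType) (S T : seq (G * G * G)) :
  perm_eq S T -> perm_eq (sixes S) (sixes T).
Proof. by move=> e; apply/perm_flatten/perm_map. Qed.

Lemma sixes_pair (G : zmodType) (s t : G * G * G) : sixes [:: s; t] = six s ++ six t.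
Proof. by []. Qed.

Lemma perm_six_swap (G : zmodType) (a b c a' b' c' : G) :
  perm_eq (six (a, b, c') ++ six (a', b', c)) (six (a, b, c) ++ six (a', b', c')).
Proof.
apply/permP => P; rewrite !count_cat /= !addn0.
move: (P a : nat) (P b : nat) (P c : nat) (P (- a) : nat) (P (- b) : nat) (P (- c) : nat).
move: (P a' : nat) (P b' : nat) (P c' : nat) (P (- a') : nat) (P (- b') : nat) (P (- c') : nat).
lia.
Qed.

Lemma perm_sixes_swapped (L H : zmodType) (x : H) (E : seq ((L * L) * (L * L))) :
  perm_eq (sixes (flatten (map (swapped_triples x) E)))
    (sixes (map (fun p => fibre_triple p x) (flatten [seq [:: e.1; e.2] | e <- E]))).
Proof.
elim: E => // e E IH.
have step (T1 T2 : eqType) (F : T1 -> seq T2) z s :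
  flatten (map F (z :: s)) = F z ++ flatten (map F s) by [].
rewrite !step map_cat !sixes_cat; apply: perm_cat IH.
rewrite /swapped_triples /= !sixes_pair; exact: perm_six_swap.
Qed.

Lemma nonzero_halves (H : finZmodType) : coprime 2 #|H| ->
  exists X : seq H, [/\ uniq X, {in X &, forall x y : H, x <> - y} & (2 * size X)%N = #|H|.-1].
Proof.
move=> co2; have d0 (x : H) : x + x = 0 -> x = 0.
  by move=> e; apply: (mulrn_eq0_coprime co2).
have [|||X e] := @perm_opp_halves H (enum [set~ (0 : H)]).
- exact: enum_uniq.
- by move=> x; rewrite !mem_enum !inE oppr_eq0.
- move=> x; rewrite mem_enum !inE; apply: contra => /eqP h.
  by apply/eqP/d0; rewrite -{1}h addNr.
have := perm_uniq e; rewrite enum_uniq cat_uniq => /esym/and3P[uX /hasPn dis _].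
exists X; split=> //.
  by move=> x y xX yX exy; have /negP[] := dis (- y) (map_f _ yX); rewrite /= -exy.
have c : #|[set~ (0 : H)]| = #|H|.-1 := cardsC1 (0 : H).
by rewrite mul2n -addnn -c cardE (perm_size e) size_cat size_map.
Qed.

(** Only the fibre over one element [x0] is swapped, so that [u] depends on its colour alone and is
    fixed before [g0] and [gu]. In all there are at least [#|H|.-1 * #|L| / 8] six-sets. *)
Lemma disjoint_sixes (L H : finZmodType) eta :
  #|L| = (2 ^ eta)%N -> (4 <= #|torsion2 L|)%N ->
  coprime 2 #|H| -> coprime 3 #|H| -> (1 < #|H|)%N ->
  exists u : L, [/\ u != 0, u + u = 0 & forall g0 gu,
    (0 < gu -> 4 * gu.+1 <= #|torsion2 L|)%N -> (8 * (g0 + gu).+1 <= #|H|.-1 * #|L|)%N ->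
    exists T0 Tu : seq ((L * H) * (L * H) * (L * H)),
      [/\ size T0 = g0, size Tu = gu, uniq (sixes (T0 ++ Tu)),
          forall g, g \in sixes (T0 ++ Tu) -> g.2 != 0 &
          {in T0, forall t, triple_sum t = 0} /\ {in Tu, forall t, triple_sum t = (u, 0)}]].
Proof.
move=> cL V4 co2 co3 H1.
have [D [cD twD]] := config_twins cL V4.
have [col [sym ok]] := double_colouring co2 co3.
have [X [uX NX sX]] := nonzero_halves co2.
have uTT := uniq_sixes cD co2 co3 sym ok uX NX.
have X0 (x : H) : x \in X -> x != 0.
  by move=> xX; apply/eqP => e; apply: (NX x x xX xX); rewrite e oppr0.
pose fib (x : H) (p : L * L) := fibre_triple p x.
have consl x s : [seq fib x p | x <- x :: s, p <- D (col x)] =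
  map (fib x) (D (col x)) ++ [seq fib x p | x <- s, p <- D (col x)] by [].
have nzTT g : g \in sixes [seq fib x p | x <- X, p <- D (col x)] -> g.2 != 0.
  move=> /flatten_mapP[_ /allpairsPdep[x [p [xX pD ->]]] /mem_six_fibre[b [[a _ [_ ->]]|[_ ->]]]].
    by case: b; rewrite /= ?oppr_eq0; apply: X0.
  suff : x + x != 0 by case: b; rewrite /= ?oppr_eq0.
  apply: contraNneq (X0 x xX) => e; apply/eqP; apply: (mulrn_eq0_coprime co2).
  by rewrite mulr2n.
have szTT : (#|H|.-1 * #|L| <= 8 * size [seq fib x p | x <- X, p <- D (col x)])%N.
  rewrite -sX; have [szD _ _ _] := cD.
  elim: (X) => [|x s IH]; first by rewrite muln0.
  rewrite consl size_cat size_map.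
  rewrite /= mulnS mulnDl mulnDr leq_add // -[8%N]/(2 * 4)%N -mulnA leq_mul2l /=.
  by have := szD (col x); rewrite cards1 muln1.
move: X0 uTT nzTT szTT; case: X sX {uX NX} => [|x0 X] sX X0; first by move: H1 sX => /=; lia.
rewrite consl; set T' := [seq fib x p | x <- X, p <- D (col x)] => uTT nzTT szTT.
have [u [E [rest [u0 u2 pD twE szE]]]] := twD (col x0).
exists u; split=> // g0 gu hgu hg.
(* A swap yields two triples of sum [(u, 0)]. For odd [gu] one of them is wasted, which the
   successor in the bound on [g0 + gu] allows. *)
pose m := uphalf gu.
have mE : (m <= size E)%N.
  rewrite /m; have [/eqP->//|gu0] := boolP (gu == 0)%N.
  have VL : (#|torsion2 L| <= #|L|)%N by apply: max_card.
  have h := hgu (_ : 0 < gu)%N; rewrite lt0n gu0 in h.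
  have := szE (leq_trans _ (h isT)) => /(_ ltac:(lia)).
  have := h isT; lia.
pose TU := flatten (map (swapped_triples x0) (take m E)).
pose TZ := map (fib x0) (flatten [seq [:: e.1; e.2] | e <- drop m E] ++ rest) ++ T'.
have e : perm_eq (sixes (TU ++ TZ)) (sixes (map (fib x0) (D (col x0)) ++ T')).
  have pT : perm_eq (map (fib x0) (D (col x0)) ++ T')
      (map (fib x0) (flatten [seq [:: e.1; e.2] | e <- take m E]) ++ TZ).
    rewrite /TZ catA perm_cat2r -map_cat perm_map //; apply: perm_trans pD _.
    by rewrite -{1}(cat_take_drop m E) map_cat flatten_cat -catA.
  rewrite perm_sym; apply: perm_trans (perm_sixes pT) _.
  by rewrite !sixes_cat perm_cat2r perm_sym; apply: perm_sixes_swapped.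
have szU : size TU = (2 * m)%N.
  rewrite /TU -[in RHS](size_takel mE); elim: (take m E) => //= e1 s ->.
  by rewrite mulnS.
have szZ : (size TZ = size (map (fib x0) (D (col x0)) ++ T') - 2 * m)%N.
  have /eqP := perm_size e; rewrite !size_sixes eqn_pmul2l // => /eqP <-.
  by rewrite (size_cat TU TZ) szU addKn.
have sumZ : {in TZ, forall t, triple_sum t = 0}.
  move=> t; rewrite mem_cat => /orP[/mapP[p _ ->]|/allpairsPdep[x [p [_ _ ->]]]];
    by rewrite /triple_sum /fib /fibre_triple /=; congr (_, _) => /=; zmod.
have sumU : {in TU, forall t, triple_sum t = (u, 0)}.
  move=> t /flatten_mapP[e1 /mem_take/twE h].
  have h2 : e1.1.1 + e1.1.2 = e1.2.1 + e1.2.2 + u by rewrite h -addrA u2 addr0.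
  rewrite !inE => /orP[/eqP ->|/eqP ->]; rewrite /triple_sum /=.
    congr (_, _) => /=; last zmod.
    by rewrite h2; zmod.
  congr (_, _) => /=; last zmod.
  by rewrite h; zmod.
clearbody TU TZ.
exists (take g0 TZ), (take gu TU).
have sub : {subset sixes (take g0 TZ ++ take gu TU) <= sixes (map (fib x0) (D (col x0)) ++ T')}.
  move=> g; rewrite -(perm_mem e) !sixes_cat !mem_cat orbC.
  have h (n : nat) (T : seq ((L * H) * (L * H) * (L * H))) : g \in sixes (take n T) -> g \in sixes T.
    by rewrite -{2}(cat_take_drop n T) sixes_cat mem_cat => ->.
  by move=> /orP[/h ->|/h ->]; rewrite ?orbT.
split.
- rewrite size_takel // szZ; move: szTT hg; rewrite /m; lia.
- by rewrite size_takel // szU /m; lia.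
- rewrite -(perm_uniq e) in uTT.
  have p : perm_eq (TU ++ TZ) ((take g0 TZ ++ take gu TU) ++ (drop g0 TZ ++ drop gu TU)).
    rewrite -{1}(cat_take_drop gu TU) -{1}(cat_take_drop g0 TZ).
    by apply/permP => a; rewrite !count_cat; lia.
  by move: uTT; rewrite (perm_uniq (perm_sixes p)) sixes_cat cat_uniq => /andP[].
- by move=> g /sub; apply: nzTT.
- by split=> t /mem_take; [apply: sumZ|apply: sumU].
Qed.

(** * Cutting the 2-torsion into cosets of a Klein group *)

Lemma mem_adjoin2 (L : finZmodType) (u v x : L) :
  x \in adjoin (adjoin [set 0] u) v -> exists k, x = klein u v k.
Proof.
rewrite !inE /klein !subr_eq0 => /orP[/orP[]|/orP[]] /eqP e.
- by exists (false, false); rewrite e /= addr0.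
- by exists (true, false); rewrite e /= addr0.
- by exists (false, true); rewrite e /= add0r.
- by exists (true, true); rewrite /= -(subrK v x) e.
Qed.

Definition quad (L : zmodType) (u v r : L) : seq L := [:: r; r + u; r + v; r + (u + v)].

Lemma quadE (L : zmodType) (u v r x : L) :
  (x \in quad u v r) <-> (exists k, x = r + klein u v k).
Proof.
rewrite !inE /klein; split.
  case/or4P => /eqP ->; [exists (false, false)|exists (true, false)|exists (false, true)|exists (true, true)];
    by rewrite /= !(mulr0n, mulr1n, addr0, add0r).
case=> [[[] []] ->]; rewrite /= !(mulr0n, mulr1n, addr0, add0r) eqxx ?orbT //.
Qed.

(** [u] is imposed, so that each coset splits into two pairs of sum [u]. The entry 0 put before [rs]
    stands for the Klein group itself. *)
Lemma torsion2_quads (L : finZmodType) (u : L) : u != 0 -> u + u = 0 -> (4 <= #|torsion2 L|)%N ->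
  exists v rs, [/\ v + v = 0, {in rs, forall r, r + r = 0},
    perm_eq (flatten (map (quad u v) (0 :: rs))) (enum (torsion2 L)) &
    #|torsion2 L| = (4 * (size rs).+1)%N].
Proof.
move=> u0 u2 V4; have h0 := zmod_closed0 L.
have uN : u \notin [set (0 : L)] by rewrite inE.
have cA : #|adjoin [set 0] u| = 2 by rewrite card_adjoin // cards1.
have hA : zmod_closed (adjoin [set 0] u) by apply: adjoin_zmod_closed; rewrite ?u2 ?inE.
have [v vV vN] : exists2 v, v \in torsion2 L & v \notin adjoin [set 0] u.
  by apply/subsetPn/negP => /subset_leq_card; rewrite cA; lia.
have v2 : v + v = 0 by move: vV; rewrite inE => /eqP.
pose K := adjoin (adjoin [set 0] u) v.
have hK : zmod_closed K by apply: adjoin_zmod_closed; rewrite // v2; case: hA.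
have cK : #|K| = 4 by rewrite card_adjoin // cA.
have kK k : klein u v k \in K.
  by apply: klein_in => //; [apply/sub_adjoin/adjoin_gen|apply: adjoin_gen].
have k2 k : klein u v k + klein u v k = 0.
  have dbl (z : L) (b : bool) : z + z = 0 -> z *+ b + z *+ b = 0.
    by case: b => //= _; rewrite addr0.
  rewrite /klein; have -> : u *+ k.1 + v *+ k.2 + (u *+ k.1 + v *+ k.2) =
    (u *+ k.1 + u *+ k.1) + (v *+ k.2 + v *+ k.2) by zmod.
  by rewrite !dbl ?addr0.
have kinj k k' : klein u v k = klein u v k' -> k = k'.
  move=> e; apply: (@klein_inj L [set 0] u v) => //; rewrite ?u2 ?v2 ?inE //.
  by rewrite e subrr.
have KV : K \subset torsion2 L.
  by apply/subsetP => x /mem_adjoin2[k ->]; rewrite inE k2.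
have [|rs [urs srs ex inj szrs]] := transversal_mod (A := torsion2 L :\: K) hK.
  move=> a n; rewrite !in_setD => /andP[aK]; rewrite inE => /eqP a2 nK; apply/andP; split.
    by apply: contra aK => h; have := hK.2 _ _ h nK; rewrite addrK.
  have := subsetP KV _ nK; rewrite inE => /eqP n2.
  rewrite inE; have -> : a + n + (a + n) = (a + a) + (n + n) by zmod.
  by rewrite a2 n2 addr0.
have rsK r : r \in rs -> r \notin K by move=> /srs; rewrite in_setD => /andP[].
have rs2 (r : L) : r \in rs -> r + r = 0 by move=> /srs; rewrite in_setD => /andP[_]; rewrite inE => /eqP.
have e0 (r x : L) k : x = r + klein u v k -> x - r \in K by move=> ->; rewrite addrAC subrr add0r kK.
exists v, rs; split=> //; last first.
  by rewrite -(cardsID K (torsion2 L)) (setIidPr KV) -szrs cK mulnS mulnC.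
have K0 : 0 \in K by case: hK.
apply: uniq_perm; first apply: uniq_flatten_map.
- by rewrite /= urs andbT; apply/negP => /rsK; rewrite K0.
- move=> r _; rewrite /quad; rewrite (_ : [:: _; _; _; _] =
    [seq r + klein u v k | k <- [:: (false, false); (true, false); (false, true); (true, true)]]).
    by rewrite map_inj_uniq // => k k' /addrI/kinj.
  by rewrite /klein /= !addr0 !add0r.
- move=> r r' rr rr' x /quadE[k xk] /quadE[k' xk'].
  have rrK : r - r' \in K.
    have -> : r - r' = (x - r') - (x - r) by zmod.
    by apply: hK.2; [apply: e0 xk'|apply: e0 xk].
  move: rr rr'; rewrite !inE => /predU1P[er|rr] /predU1P[er'|rr'].
  + by rewrite er er'.
  + by move: rrK; rewrite er sub0r => /(zmod_closed_opp_in hK); rewrite opprK (negbTE (rsK _ rr')).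
  + by move: rrK; rewrite er' subr0 (negbTE (rsK _ rr)).
  + exact: inj.
- exact: enum_uniq.
- move=> x; rewrite mem_enum; apply/flatten_mapP/idP => [[r rr /quadE[k ->]]|xV].
    have r2 : r + r = 0 by move: rr; rewrite inE => /predU1P[->|/rs2//]; rewrite addr0.
    rewrite inE; have -> : r + klein u v k + (r + klein u v k) = (r + r) + (klein u v k + klein u v k) by zmod.
    by rewrite r2 k2 addr0.
  have [xK|xK] := boolP (x \in K).
    by exists 0; rewrite ?mem_head //; have [k ->] := mem_adjoin2 xK; apply/quadE; exists k; rewrite add0r.
  have [|r rr xr] := ex x; first by rewrite in_setD xK.
  exists r; first by rewrite inE rr orbT.
  by apply/quadE; have [k ek] := mem_adjoin2 xr; exists k; rewrite -ek addrC subrK.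
Qed.

(** * Zero-sum triples and 5-sets from six-sets *)

Lemma zs_split_six (G : zmodType) (T : seq (G * G * G)) :
  {in T, forall t, triple_sum t = 0} -> zs_split (sixes T) (nseq (2 * size T) 3).
Proof.
elim: T => [|[[x y] z] T IH] hT; first by exists [::].
have -> : sixes ((x, y, z) :: T) = [:: x; y; z] ++ ([:: - x; - y; - z] ++ sixes T) by [].
rewrite [size _]/= mulnS -[nseq _ 3]/([:: 3] ++ ([:: 3] ++ nseq (2 * size T) 3))%N.
have s0 : x + y + z = 0 := hT _ (mem_head _ _).
apply: zs_split_cat; last apply: zs_split_cat; last by apply: IH => t tT; apply: hT; rewrite inE tT orbT.
  by apply: zs_split1; rewrite !big_cons big_nil addr0 addrA.
apply: zs_split1; rewrite !big_cons big_nil; transitivity (- (x + y + z)); first zmod.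
by rewrite s0 oppr0.
Qed.

Lemma zs_split_quads_sixes (G : zmodType) (w : G) (Q : seq (G * G * G * G)) (T : seq (G * G * G)) :
  size Q = size T -> w + w = 0 -> {in Q, forall q, q.1.1.1 + q.1.1.2 = w /\ q.1.2 + q.2 = w} ->
  {in T, forall t, triple_sum t = w} ->
  zs_split (flatten [seq [:: q.1.1.1; q.1.1.2; q.1.2; q.2] | q <- Q] ++ sixes T)
    (nseq (2 * size T) 5).
Proof.
move=> + w2; elim: Q T => [|[[[a b] c] d] Q IH] [|[[x y] z] T] // => [_ _ _|[sz] hQ hT].
  by exists [::].
have [ab cd] := hQ _ (mem_head _ _); have xyz : x + y + z = w := hT _ (mem_head _ _).
rewrite [size (_ :: T)]/= mulnS; apply: (@zs_split_perm _ ([:: a; b; x; y; z] ++ ([:: c; d; - x; - y; - z] ++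
   (flatten [seq [:: q.1.1.1; q.1.1.2; q.1.2; q.2] | q <- Q] ++ sixes T)))
   _ ([:: 5] ++ ([:: 5] ++ nseq (2 * size T) 5))%N) => //.
  rewrite [map _ _]/= [flatten _]/=; set F := flatten _; apply/permP => P.
  have -> : sixes ((x, y, z) :: T) = six (x, y, z) ++ sixes T by [].
  rewrite /= !count_cat /=; move: (count P F) (count P (sixes T)) => *.
  ring.
apply: zs_split_cat; last apply: zs_split_cat.
- apply: zs_split1; rewrite !big_cons big_nil.
  transitivity ((a + b) + (x + y + z)); first zmod.
  by rewrite ab xyz w2.
- apply: zs_split1; rewrite !big_cons big_nil.
  transitivity ((c + d) - (x + y + z)); first zmod.
  by rewrite cd xyz subrr.
- apply: IH => //; first by move=> q qQ; apply: hQ; rewrite inE qQ orbT.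
  by move=> t tT; apply: hT; rewrite inE tT orbT.
Qed.

(** * Numerical bounds *)

(* Here |L| = 4l, |H| = h, |V| = 4(q + 1); o, ms5 and msn count the odd parts, the
   parts equal to 5 and the parts different from 5, and sm is the sum of the parts. *)
Lemma part_counts (l h q ms5 msn o sm : nat) :
  (q.+1 <= l)%N -> (5 <= h)%N -> (h = 5 \/ 11 <= h)%N -> sm.+1 = (4 * (l * h))%N ->
  (sm <= 7 * msn + 5 * ms5)%N -> (5 * o <= sm)%N -> odd o = odd sm -> (ms5 <= o)%N ->
  let q1 := minn q msn in let gu := (q - q1)%N in
  [/\ (2 * gu <= ms5)%N, (o = 1 + 2 * ((o - 1) %/ 2))%N,
      (2 * gu < o)%N & (8 * ((o - 1) %/ 2).+1 <= h.-1 * (4 * l))%N].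
Proof.
move=> ql h5 h511 esm sm7 so oo mo /=.
have lh : (5 * l <= l * h)%N by rewrite mulnC leq_mul2l h5 orbT.
have o_odd : odd o by rewrite oo; move: esm; lia.
(* If [msn < q], then [sm] is at least [20 * q.+1 - 1], too much for the parts different from 5, and
   this forces many parts equal to 5. *)
have gu5 : (2 * (q - minn q msn) <= ms5)%N by lia.
split; [by []|lia|lia|].
(* This follows from [5 * o < 4 * l * h]; the bound is sharp enough already at [h = 5], and for
   [h >= 11] there is room to spare. *)
have cap : (o.+1 <= l * h.-1)%N.
  case: h511 => [eh|h11]; first by subst h => /=; lia.
  have lh11 : (11 * l <= l * h)%N by rewrite mulnC leq_mul2l h11 orbT.
  have -> : (l * h.-1 = l * h - l)%N by rewrite -subn1 mulnBr muln1.
  lia.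
have -> : (h.-1 * (4 * l) = 4 * (l * h.-1))%N by rewrite mulnCA (mulnC h.-1).
lia.
Qed.

Lemma sumn_4to7 (ms : seq nat) : all (fun m => 4 <= m <= 7)%N ms ->
  [/\ (sumn ms <= 7 * count (predC1 5) ms + 5 * count (pred1 5) ms)%N,
      (5 * count odd ms <= sumn ms)%N, odd (count odd ms) = odd (sumn ms) &
      (count (pred1 5) ms <= count odd ms)%N].
Proof.
elim: ms => [|m ms IH] //= /andP[m47 /IH[h1 h2 h3 h4]].
have {m47} : m \in [:: 4; 5; 6; 7]%N by rewrite !inE; clear -m47; lia.
move: h1 h2 h3 h4; move: (count (predC1 5) ms) (count (pred1 5) ms) (count odd ms) (sumn ms).
move=> cn c5 co s h1 h2 h3 h4; rewrite !oddD h3 oddb.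
by rewrite !inE => /or4P[] /eqP -> /=; split=> //; lia.
Qed.

Lemma opp_mem_sixes (G : zmodType) (T : seq (G * G * G)) x : x \in sixes T -> - x \in sixes T.
Proof.
move=> /flatten_mapP[t tT xt]; apply/flatten_mapP; exists t => //; move: xt.
rewrite !inE !(eqr_oppLR _ (- _)) !opprK !(eqr_oppLR _ _).
by case/or4P => [->|->|->|/or3P[->|->|->]]; rewrite ?orbT.
Qed.

(** * Assembling the partition *)

Lemma zs_split_product (L H : finZmodType) eta (ms : seq nat) :
  #|L| = (2 ^ eta)%N -> (4 <= #|torsion2 L|)%N -> (#|H| %% 6 = 5)%N ->
  all (leq 4) ms -> sumn ms = (#|L| * #|H|).-1 ->
  exists2 s : seq (L * H), perm_eq (0 :: s) (enum {: L * H}) & zs_split s ms.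
Proof.
move=> cL V4 H6 ms4 sms.
have co2 : coprime 2 #|H| by rewrite coprime2n -(@odd_mod _ 6) // H6.
have co3 : coprime 3 #|H|.
  rewrite prime_coprime //; apply/negP => /dvdnP[k ek]; rewrite ek in H6; lia.
have H5 : (5 <= #|H|)%N by lia.
have [u [u0 u2 six_ex]] := disjoint_sixes cL V4 co2 co3 (leq_trans (isT : 1 < 5)%N H5).
have [v [rs [v2 rs2 pV cV]]] := torsion2_quads u0 u2 V4.
have [l el] : exists l, #|L| = (4 * l)%N.
  have /dvdnP[k ->] := card_zmod_dvdn (torsion2_zmod_closed L); exists (k * (size rs).+1)%N.
  by rewrite cV mulnCA.
have VL : (#|torsion2 L| <= #|L|)%N by apply: max_card.
have [ms' [ms47 sms' co]] := coarsens_4to7 ms4.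
have [s1 s2 s3 s4] := sumn_4to7 ms47.
set o := count odd ms' in s2 s3 s4; set ms5 := count (pred1 5) ms' in s1 s4.
set msn := count (predC1 5) ms' in s1; pose q := size rs.
have L0 : (0 < #|L| * #|H|)%N by rewrite muln_gt0 el; lia.
have h511 : (#|H| = 5 \/ 11 <= #|H|)%N.
  by move: H6 H5; move: #|H| => h; clear; move=> h6 h5; have := divn_eq h 6; lia.
have esm : (sumn ms').+1 = (4 * (l * #|H|))%N by rewrite sms' sms prednK // el mulnA.
have ql : (q.+1 <= l)%N by move: VL; rewrite cV el leq_mul2l.
have [g1 g2 g3 g4] := part_counts ql H5 h511 esm s1 s2 s3 s4.
(* [q1] cosets serve as 4-blocks and the other [gu] are joined with six-sets. The [o] odd parts
   receive [2 * gu] blocks of size 5, the triple of the Klein group and the [2 * (k - gu)] triples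
   of [T0]. *)
set q1 := minn q msn in g1 g3; set gu := (q - q1)%N in g1 g3.
set k := ((o - 1) %/ 2)%N in g2 g4.
have guk : (gu <= k)%N by lia.
have [||T0 [Tu [sT0 sTu u6 nz6 [sum0 sumu]]]] := six_ex (k - gu)%N gu.
- by move=> _; rewrite cV leq_mul2l /= ltnS leq_subr.
- by rewrite subnK // el; exact: g4.
pose iL (x : L) : L * H := (x, 0).
have iLD : {morph iL : x y / x + y} by move=> x y; congr (_, _); rewrite addr0.
have iL_inj : injective iL by move=> x y [].
pose rest := [seq g <- enum {: L * H} | (g + g != 0) && (g \notin sixes (T0 ++ Tu))].
have d0 (x : H) : x + x = 0 -> x = 0 by move=> e; apply: (mulrn_eq0_coprime co2).
have pW : perm_eq (map iL (flatten (map (quad u v) (0 :: rs))) ++ (sixes (T0 ++ Tu) ++ rest))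
    (enum {: L * H}).
  (* As [H] has odd order, the 2-torsion of the product lies in the first factor. *)
  have tors g : reflect (g + g = 0) (g \in map iL (flatten (map (quad u v) (0 :: rs)))).
    apply: (iffP mapP) => [[x + ->]|].
      by rewrite (perm_mem pV) mem_enum inE => /eqP x2; rewrite -iLD x2.
    case: g => x y [x2 /d0 ->]; exists x => //.
    by rewrite (perm_mem pV) mem_enum inE x2.
  apply: uniq_perm.
  - rewrite !cat_uniq u6 filter_uniq ?enum_uniq // map_inj_uniq // (perm_uniq pV) enum_uniq.
    rewrite andbT /=; apply/andP; split; last first.
      by apply/hasPn => g; rewrite mem_filter => /andP[/andP[]].
    apply/hasPn => g; rewrite mem_cat mem_filter => /orP[/nz6 gn|/andP[/andP[gn _] _]].
      by apply/negP => /tors; case: g gn => x y /= y0 [_ /d0/eqP]; apply/negP.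
    by apply/negP => /tors/eqP; apply/negP.
  - exact: enum_uniq.
  - move=> g; rewrite !mem_cat mem_filter mem_enum andbT.
    have [gg|gg] := eqVneq (g + g) 0; first by rewrite (introT (tors g) gg).
    by case: (g \in sixes _); rewrite ?orbT.
have zquads rs' : {subset rs' <= rs} ->
    zs_split (map iL (flatten (map (quad u v) rs'))) (nseq (size rs') 4).
  move=> sub; apply: zs_split_map => //; rewrite -(size_map (quad u v)).
  apply: zs_split_nseq => _ /mapP[r rr ->]; split=> //.
  rewrite !big_cons big_nil; transitivity ((r + r) + (r + r) + (u + u) + (v + v)); first zmod.
  by rewrite (rs2 _ (sub _ rr)) u2 v2 !addr0.
have zfives : zs_split (map iL (flatten (map (quad u v) (drop q1 rs))) ++ sixes Tu)
    (nseq (2 * gu) 5).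
  pose Q := [seq (iL r, iL (r + u), iL (r + v), iL (r + (u + v))) | r <- drop q1 rs].
  have -> : map iL (flatten (map (quad u v) (drop q1 rs))) =
      flatten [seq [:: q.1.1.1; q.1.1.2; q.1.2; q.2] | q <- Q].
    by rewrite map_flatten -!map_comp.
  rewrite -sTu; apply: (zs_split_quads_sixes (w := iL u)) => //.
  - by rewrite size_map size_drop sTu.
  - by rewrite -iLD u2.
  - move=> _ /mapP[r /mem_drop/rs2 r2 ->]; rewrite -!iLD; split; congr iL.
      by rewrite addrA r2 add0r.
    transitivity ((r + r) + (v + v) + u); first zmod.
    by rewrite r2 v2 !add0r.
have allW (g : L * H) : g \in enum {: L * H} by rewrite mem_enum.
have zrest : zs_split rest (nseq (size rest)./2 2).
  apply: zs_split_opp_closed; first by rewrite filter_uniq ?enum_uniq.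
  - move=> g; rewrite mem_filter => /andP[/andP[n1 n2] _].
    rewrite mem_filter allW andbT -opprD oppr_eq0 n1 /=.
    by apply: contra n2 => /opp_mem_sixes; rewrite opprK.
  - move=> g; rewrite mem_filter => /andP[/andP[gn _] _]; apply: contra gn => /eqP e.
    by rewrite -{1}e addNr.
have z3 : zs_split (map iL [:: 0 + u; 0 + v; 0 + (u + v)]) [:: 3%N].
  apply: zs_split_map => //; apply: zs_split1; rewrite !big_cons big_nil.
  transitivity ((u + u) + (v + v)); first zmod.
  by rewrite u2 v2 addr0.
have z0 := zs_split_six sum0.
pose s := map iL [:: 0 + u; 0 + v; 0 + (u + v)] ++ (map iL (flatten (map (quad u v) rs)) ++
  (sixes (T0 ++ Tu) ++ rest)).
(* The list in [pW] begins with [iL 0], which is the zero of the product. *)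
have pWs : perm_eq (0 :: s) (enum {: L * H}) by apply: perm_trans pW.
exists s => //.
have zs : zs_split s ([:: 3] ++ (nseq q1 4 ++ (nseq (2 * gu) 5 ++
    (nseq (2 * (k - gu)) 3 ++ nseq (size rest)./2 2))))%N.
  have zall := zs_split_cat z3 (zs_split_cat (zquads _ (mem_take (n0 := q1) (s := rs)))
    (zs_split_cat zfives (zs_split_cat z0 zrest))).
  have sq1 : size (take q1 rs) = q1 by rewrite size_takel // geq_minl.
  rewrite sq1 sT0 in zall; apply: zs_split_perm (perm_refl _) zall.
  rewrite perm_cat2l -{3}(cat_take_drop q1 rs) !map_cat flatten_cat map_cat sixes_cat -!catA.
  rewrite !perm_cat2l; set A := sixes T0; set B := sixes Tu.
  by rewrite perm_catCA.
apply: co; apply: (coarsens_from_2345 (q := q1) (f := (2 * gu)%N) (o := (1 + 2 * (k - gu))%N)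
  (p := (size rest)./2) ms47).
- exact: geq_minr.
- exact: g1.
- by rewrite -/o; lia.
- have := zs_split_size zs; rewrite !sumn_cat !sumn_nseq.
  have -> : size s = sumn ms'.
    have := perm_size pWs; rewrite -cardE card_prod /= => e.
    by rewrite sms' sms -e.
  by move=> <-; rewrite [sumn _]/=; ring.
apply: zs_split_perm (perm_refl _) _ zs.
apply/permP => P; rewrite !count_cat !count_nseq /=; ring.
Qed.


Theorem theorem2p5 (G L H : finZmodType) (f : L * H -> G)
  (f_add : forall u v, f (u + v) = f u + f v)
  (f_bij : bijective f)
  (hL : exists eta : nat, #|L| = (2 ^ eta)%N)
  (hIL : (1 < #|involutions L|)%N)
  (hH : (#|H| %% 6 = 5)%N) :
  ZSPP 4 G.
Proof.
have [eta cL] := hL; have f_inj := bij_inj f_bij.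
have f0 : f 0 = 0 by apply: (addrI (f 0)); rewrite -f_add !addr0.
have cG : #|G| = (#|L| * #|H|)%N by rewrite -(bij_eq_card f_bij) card_prod.
(* The 2-torsion has more than 2 elements by [hIL], and its order divides a power of 2. *)
have V4 : (4 <= #|torsion2 L|)%N.
  have := card_zmod_dvdn (torsion2_zmod_closed L); rewrite cL => /(dvdn_pfactor _ _ (isT : prime 2))[m _].
  have := card_torsion2 L; case: m => [|[|m]] => [-> e|-> e|_ ->].
  - by move: hIL; rewrite -ltnS e.
  - by move: hIL; rewrite -ltnS e.
  - by rewrite (leq_pexp2l (m := 2) (n1 := 2)).
apply: ZSPP_of_zs_split => ms ms4 sms; rewrite cG in sms.
have [s ps zs] := zs_split_product cL V4 hH ms4 sms.
apply: zs_split_perm (perm_refl _) (zs_split_map f_add zs).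
have us : uniq (0 :: s) by rewrite (perm_uniq ps) enum_uniq.
apply: uniq_perm; first by rewrite map_inj_uniq //; case/andP: us.
  exact: enum_uniq.
have [g gK fK] := f_bij.
move=> x; rewrite mem_enum !inE -(fK x) mem_map // -[X in _ = (_ != X)]f0 (inj_eq f_inj).
have : g x \in 0 :: s by rewrite (perm_mem ps) mem_enum.
rewrite inE; have [->|//] := eqVneq (g x) 0.
by case/andP: us => /negbTE ->.
Qed.
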